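(* Let $\rho$ be an antisymmetric Fox pairing of degree $n\in\mathbb{Z}$ in a cocommutative graded Hopf algebra $A$. Let $\bullet$ be a balanced biderivation in a commutative ungraded Hopf algebra $B$. Let $\{-,-\}$ be the unique $n$-graded bracket in $A_B$ such that $$\{x_b,y_c\}=(-1)^{|x''|\,|y'|_n}\,(c''\bullet b^{(2)})\;\rho(x',y')_{s_B(b^{(3)})\,b^{(1)}}\;x''_{b^{(4)}}\;y''_{c'}\qquad (x,y\in A,\ b,c\in B).$$ Then, for any $x,y\in A$ and any cosymmetric $b,c\in B$, $$\{x_b,y_c\}=(b\smile c)\,\Theta_\rho(\check x,\check y)\ \in A_B^{\mathrm{inv}} .$$
   Context: Conventions. $\mathbb{K}$ is a fixed commutative ring; all objects are over $\mathbb{K}$, and $\otimes=\otimes_{\mathbb{K}}$ unless indicated. ''Graded'' means $\mathbb{Z}$-graded; ''ungraded'' objects are concentrated in degree $0$. For homogeneous $x$, $|x|$ is its degree and $|x|_n=|x|+n$. The tensor product of graded algebras has multiplication $(x\otimes b)(y\otimes c)=(-1)^{|b||y|}xy\otimes bc$. A graded algebra is commutative if $xy=(-1)^{|x||y|}yx$. In a graded bialgebra the comultiplication $\Delta_A$ and counit $\varepsilon_A$ are graded algebra homomorphisms; a graded Hopf algebra has in addition a graded linear antipode $s_A$ with $s_A(x')x''=x's_A(x'')=\varepsilon_A(x)1_A$. Sweedler notation: $\Delta(x)=x'\otimes x''=x^{(1)}\otimes x^{(2)}$, with iterated versions; components are homogeneous and, for $x$ homogeneous, their degrees sum to $|x|$.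 $A$ is cocommutative if $x'\otimes x''=(-1)^{|x'||x''|}x''\otimes x'$ (then $s_A^2=\mathrm{id}$). Representation algebra. $A_B$ is the graded algebra generated by symbols $x_b$ ($x\in A$, $b\in B$), with $|x_b|=|x|+|b|$ for homogeneous $x,b$, subject to: bilinearity of $x_b$ in $(x,b)$; $(xy)_b=x_{b'}y_{b''}$; $(1_A)_b=\varepsilon_B(b)1$; $x_{bc}=x'_bx''_c$; $x_{(1_B)}=\varepsilon_A(x)1$; and $x_by_c=(-1)^{|x_b||y_c|}y_cx_b$. There is a unique $B$-coaction $\Delta:A_B\to A_B\otimes B$ (graded algebra homomorphism making $A_B$ a right $B$-comodule) with $\Delta(x_b)=x_{b''}\otimes s_B(b')b'''$; $A_B^{\mathrm{inv}}=\{m\in A_B:\Delta(m)=m\otimes1_B\}$. Fox pairings. A Fox pairing of degree $n$ in $A$ is a bilinear map $\rho:A\times A\to A$ with $\rho(A^p,A^q)\subset A^{p+q+n}$, $\rho(x,yz)=\rho(x,y)z+\varepsilon_A(y)\rho(x,z)$ and $\rho(xy,z)=\rho(x,z)\varepsilon_A(y)+x\rho(y,z)$. It is antisymmetric if $(-1)^{|x|_n|y|_n}s_A^{-1}\rho(s_A(y),s_A(x))=-\rho(x,y)$ for homogeneous $x,y$. Balanced biderivations. A bilinear form $\bullet:B\times B\to\mathbb{K}$ is a biderivation if $(bc)\bullet d=\varepsilon_B(b)\,c\bullet d+\varepsilon_B(c)\,b\bullet d$ and $b\bullet(cd)=\varepsilon_B(c)\,b\bullet d+\varepsilon_B(d)\,b\bullet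 c$; it is balanced if $(b\bullet c'')s_B(c')c'''=(c\bullet b'')s_B(b''')b'$ for all $b,c$. An element $b\in B$ is cosymmetric if $b'\otimes b''=b''\otimes b'$. Brackets. An $n$-graded bracket in a graded algebra $R$ is a bilinear map $\{-,-\}:R\times R\to R$ with $\{R^p,R^q\}\subset R^{p+q+n}$ and, for homogeneous $x,y,z$, $\{x,yz\}=\{x,y\}z+(-1)^{|x|_n|y|}y\{x,z\}$ and $\{xy,z\}=x\{y,z\}+(-1)^{|y||z|_n}\{x,z\}y$. The bracket in the claim exists and is unique. Operations. $\check A=A/[A,A]$, where $[A,A]$ is the submodule generated by $yz-(-1)^{|y||z|}zy$ for homogeneous $y,z$; $\check x$ is the class of $x$. The left and right adjoint actions are, for homogeneous $y,z$, $\mathrm{ad}^\ell(y,z)=(-1)^{|z||y''|}y'\,z\,s_A(y'')$ and $\mathrm{ad}^r(z,y)=(-1)^{|z||y'|}s_A(y')\,z\,y''$; they define a left $A$-module ${}^\ell\!A$ and a right $A$-module $A^r$ with underlying module $A$, and $A^r\otimes_A{}^\ell\!A$ is their tensor product over $A$. The bilinear map $\Theta_\rho:\check A\times\check A\to A^r\otimes_A{}^\ell\!A$ is the (well-defined) map with $\Theta_\rho(\check x,\check y)=\mathrm{ad}^r(x',\rho(x'',y'))\otimes y''=x'\otimes\mathrm{ad}^\ell(\rho(x'',y'),y'')$ for $x,y\in A$. For cosymmetric $b,c\in B$, $b\smile c:A^r\otimes_A{}^\ell\!A\to A_B^{\mathrm{inv}}$ is the (well-defined) linear map carrying $x\otimes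 y$ to $(b'\bullet c')\,x_{b''}\,y_{c''}$. *)

(* Defs.v *)
From HB Require Import structures.
From mathcomp Require Import all_boot all_algebra.
From mathcomp Require Import finmap boolp classical_sets monalg.

Set Implicit Arguments.
Unset Strict Implicit.
Unset Printing Implicit Defensive.

Import GRing.Theory.
Local Open Scope ring_scope.
Local Open Scope quotient_scope.

(* The constants below defined by [locked_with] are sealed because conversion
   problems that reach the underlying finitely supported functions are slow. *)
Fact quot_key : unit. Proof. exact: tt. Qed.

Section LinearQuotient.
Context (K : comNzRingType) (V : lmodType K) (S : V -> Prop).

Inductive lspan : V -> Prop :=
| lspan_gen v : S v -> lspan v
| lspan0 : lspan 0
| lspanP a u v : lspan u -> lspan v -> lspan (a *: u + v).

Definition in_lspan : {pred V} := fun v => `[< lspan v >].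

Lemma in_lspan_closed : submod_closed in_lspan.
Proof.
split=> [|a u v]; rewrite !unfold_in; first exact/asboolP/lspan0.
by move=> /asboolP hu /asboolP hv; apply/asboolP/lspanP.
Qed.

HB.instance Definition _ := GRing.isSubmodClosed.Build K V in_lspan
  in_lspan_closed.

Definition lquot : Type := Quotient.quot in_lspan.
HB.instance Definition _ := EqQuotient.on lquot.
HB.instance Definition _ := GRing.Zmodule.on lquot.

Definition lproj : V -> lquot := locked_with quot_key \pi_lquot.

Lemma lprojE v : lproj v = \pi_lquot v.
Proof. by rewrite /lproj unlock. Qed.

Lemma lproj_eqP u v : lproj u = lproj v <-> lspan (u - v).
Proof.
have -> : lspan (u - v) <-> u - v \in in_lspan.
  by split=> [h|/asboolP //]; apply/asboolP.
by rewrite Quotient.idealrBE !lprojE; split=> /eqP.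
Qed.

Lemma lproj_repr (t : lquot) : lproj (repr t) = t.
Proof. by rewrite lprojE reprK. Qed.

Lemma lprojB : {morph lproj : u v / u - v}.
Proof. by move=> u v; rewrite !lprojE !piE. Qed.

Lemma lprojD : {morph lproj : u v / u + v}.
Proof. by move=> u v; rewrite !lprojE !piE. Qed.

Definition lquot_scale : K -> lquot -> lquot :=
  locked_with quot_key (fun a t => lproj (a *: repr t)).

Lemma lquot_scaleE a v : lquot_scale a (lproj v) = lproj (a *: v).
Proof.
rewrite /lquot_scale unlock; apply/lproj_eqP.
rewrite -scalerBr -[_ *: _]addr0; apply: lspanP lspan0.
exact/lproj_eqP/lproj_repr.
Qed.

Fact lquot_scaleA a b v :
  lquot_scale a (lquot_scale b v) = lquot_scale (a * b) v.
Proof. by rewrite -[v]lproj_repr !lquot_scaleE scalerA. Qed.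

Fact lquot_scale1 : left_id 1 lquot_scale.
Proof. by move=> v; rewrite -[v]lproj_repr lquot_scaleE scale1r. Qed.

Fact lquot_scaleDr : right_distributive lquot_scale +%R.
Proof.
move=> a u v; rewrite -[u]lproj_repr -[v]lproj_repr.
by rewrite -lprojD !lquot_scaleE scalerDr lprojD.
Qed.

Fact lquot_scaleDl v : {morph lquot_scale^~ v : a b / a + b}.
Proof.
by move=> a b; rewrite -[v]lproj_repr !lquot_scaleE scalerDl lprojD.
Qed.

HB.instance Definition _ := GRing.Zmodule_isLmodule.Build K lquot
  lquot_scaleA lquot_scale1 lquot_scaleDr lquot_scaleDl.

Fact lproj_is_linear : linear lproj.
Proof. by move=> a u v; rewrite lprojD -lquot_scaleE. Qed.

HB.instance Definition _ := GRing.isLinear.Build K V lquot _ lproj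
  lproj_is_linear.

Lemma lprojZ a : {morph lproj : v / a *: v}.
Proof. by move=> v; rewrite linearZ. Qed.

End LinearQuotient.

Section AlgebraQuotient.
Context (K : comNzRingType) (R : algType K) (S : R -> Prop).

Definition ideal_gen (r : R) : Prop := exists u s v, S s /\ r = u * s * v.

Definition aquot : Type := lquot ideal_gen.
HB.instance Definition _ := GRing.Lmodule.on aquot.

Definition aproj : R -> aquot := @lproj K R ideal_gen.
HB.instance Definition _ := GRing.Linear.on aproj.

Lemma aproj_repr (t : aquot) : aproj (repr t) = t.
Proof. exact: lproj_repr. Qed.

Lemma lspan_mull r s : lspan ideal_gen s -> lspan ideal_gen (r * s).
Proof.
elim=> [_ [u [t [v [St ->]]]]||a u v _ IHu _ IHv].
- by apply: lspan_gen; exists (r * u), t, v; split=> //; rewrite !mulrA.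
- by rewrite mulr0; apply: lspan0.
- by rewrite mulrDr -scalerAr; apply: lspanP.
Qed.

Lemma lspan_mulr r s : lspan ideal_gen s -> lspan ideal_gen (s * r).
Proof.
elim=> [_ [u [t [v [St ->]]]]||a u v _ IHu _ IHv].
- by apply: lspan_gen; exists u, t, (v * r); split=> //; rewrite !mulrA.
- by rewrite mul0r; apply: lspan0.
- by rewrite mulrDl -scalerAl; apply: lspanP.
Qed.

Definition aquot_one : aquot := aproj 1.
Definition aquot_mul : aquot -> aquot -> aquot :=
  locked_with quot_key (fun s t => aproj (repr s * repr t)).

Lemma aprojM r s : aquot_mul (aproj r) (aproj s) = aproj (r * s).
Proof.
have h u : lspan ideal_gen (repr (aproj u) - u) by exact/lproj_eqP/lproj_repr.
rewrite /aquot_mul unlock; apply/lproj_eqP.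
rewrite -(subrKA (r * repr (aproj s))) -mulrBl -mulrBr.
rewrite -[_ * repr _]scale1r.
by apply: lspanP; [apply: lspan_mulr | apply: lspan_mull].
Qed.

Fact aquot_mulA : associative aquot_mul.
Proof.
move=> r s t; rewrite -[r]aproj_repr -[s]aproj_repr -[t]aproj_repr.
by rewrite !aprojM mulrA.
Qed.

Fact aquot_mul1r : left_id aquot_one aquot_mul.
Proof. by move=> r; rewrite -[r]aproj_repr aprojM mul1r. Qed.

Fact aquot_mulr1 : right_id aquot_one aquot_mul.
Proof. by move=> r; rewrite -[r]aproj_repr aprojM mulr1. Qed.

Fact aquot_mulDl : left_distributive aquot_mul +%R.
Proof.
move=> r s t; rewrite -[r]aproj_repr -[s]aproj_repr -[t]aproj_repr.
by rewrite -(raddfD aproj) !aprojM mulrDl (raddfD aproj).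
Qed.

Fact aquot_mulDr : right_distributive aquot_mul +%R.
Proof.
move=> r s t; rewrite -[r]aproj_repr -[s]aproj_repr -[t]aproj_repr.
by rewrite -(raddfD aproj) !aprojM mulrDr (raddfD aproj).
Qed.

HB.instance Definition _ := GRing.Zmodule_isPzRing.Build aquot
  aquot_mulA aquot_mul1r aquot_mulr1 aquot_mulDl aquot_mulDr.

Fact aproj_is_monoid_morphism : monoid_morphism aproj.
Proof. by split=> // r s; rewrite -aprojM. Qed.

HB.instance Definition _ := GRing.isMonoidMorphism.Build R aquot aproj
  aproj_is_monoid_morphism.

Lemma aprojZ a r : aproj (a *: r) = a *: aproj r.
Proof. exact: linearZ. Qed.

Lemma aprojMr r s : aproj (r * s) = aproj r * aproj s.
Proof. by rewrite -aprojM. Qed.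

Lemma aquot_scaleAl (a : K) (s t : aquot) : a *: (s * t) = (a *: s) * t.
Proof.
rewrite -[s]aproj_repr -[t]aproj_repr.
by rewrite -aprojMr -!aprojZ -aprojMr -scalerAl.
Qed.

Lemma aquot_scaleAr (a : K) (s t : aquot) : a *: (s * t) = s * (a *: t).
Proof.
rewrite -[s]aproj_repr -[t]aproj_repr.
by rewrite -aprojMr -!aprojZ -aprojMr -scalerAr.
Qed.

End AlgebraQuotient.

Lemma malg_scaleU (K : comNzRingType) (M : choiceType) (a c : K) (m : M) :
  a *: << c *g m >> = << a * c *g m >> :> {malg K[M]}.
Proof. by apply/malgP=> k; rewrite mcoeffZ !mcoeffU mulrnAr. Qed.

Lemma malg_scaleAr (K : comNzRingType) (M : monomType) (a : K)
  (f g : {malg K[M]}) : a *: (f * g) = f * (a *: g).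
Proof.
rewrite (malgMEw (fsubset_refl _) (msuppZ_le a g)) malgME scaler_sumr.
apply: eq_bigr => k _; rewrite scaler_sumr; apply: eq_bigr => l _.
by rewrite malg_scaleU mcoeffZ mulrCA.
Qed.

Section FreeAlgebra.
Context (K : comNzRingType) (X : choiceType).

Definition free_alg : Type := {malg K[{fmonom X}]}.
HB.instance Definition _ := GRing.Lalgebra.on free_alg.

HB.instance Definition _ := GRing.Lalgebra_isAlgebra.Build K free_alg
  (@malg_scaleAr K {fmonom X}).

Definition fvar : X -> free_alg :=
  locked_with quot_key (fun x => << fmu x >>).

Lemma fvarE x : fvar x = << fmu x >>.
Proof. by rewrite /fvar unlock. Qed.

End FreeAlgebra.

Section TensorProduct.
Context (K : comNzRingType) (M N : lmodType K).

Definition tens_sym : M -> N -> {malg K[(M * N)%type]} :=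
  locked_with quot_key (fun x y => << (x, y) >>).

Lemma tens_symE x y : tens_sym x y = << (x, y) >>.
Proof. by rewrite /tens_sym unlock. Qed.

Local Notation sym := tens_sym.

Inductive tens_rel : {malg K[(M * N)%type]} -> Prop :=
| tens_rel_l a x x' y :
    tens_rel (sym (a *: x + x') y - (a *: sym x y + sym x' y))
| tens_rel_r a x y y' :
    tens_rel (sym x (a *: y + y') - (a *: sym x y + sym x y')).

Definition tens : Type := lquot tens_rel.
HB.instance Definition _ := GRing.Lmodule.on tens.

Definition tpure (x : M) (y : N) : tens := lproj tens_rel (sym x y).

Lemma tpure_linearl y : linear (tpure^~ y).
Proof.
move=> a x x'; rewrite -linearP; apply/lproj_eqP/lspan_gen; exact: tens_rel_l.
Qed.

Lemma tpure_linearr x : linear (tpure x).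
Proof.
move=> a y y'; rewrite -linearP; apply/lproj_eqP/lspan_gen; exact: tens_rel_r.
Qed.

HB.instance Definition _ x := GRing.isLinear.Build K N tens _ (tpure x)
  (tpure_linearr x).

Lemma tpure0l y : tpure 0 y = 0.
Proof.
by have := tpure_linearl y (-1) 0 0; rewrite scaler0 addr0 scaleN1r addNr.
Qed.

Lemma tpureZl a x y : tpure (a *: x) y = a *: tpure x y.
Proof. by have := tpure_linearl y a x 0; rewrite tpure0l !addr0. Qed.

Lemma tpure_suml (I : Type) (r : seq I) (F : I -> M) y :
  tpure (\sum_(i <- r) F i) y = \sum_(i <- r) tpure (F i) y.
Proof.
apply: (big_morph (tpure^~ y)) => [x x'|]; last exact: tpure0l.
by rewrite -[x in LHS]scale1r tpure_linearl scale1r.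
Qed.

Lemma tens_sumP (t : tens) :
  exists s : seq (M * N), t = \sum_(i <- s) tpure i.1 i.2.
Proof.
rewrite -[t]lproj_repr [repr t]monalgE raddf_sum.
elim: (enum_fset _) => [|k l [s IH]]; first by exists [::]; rewrite !big_nil.
exists (((repr t)@_k *: k.1, k.2) :: s); rewrite !big_cons IH; congr (_ + _).
have -> : << (repr t)@_k *g k >> = (repr t)@_k *: sym k.1 k.2.
  by rewrite tens_symE malg_scaleU mulr1 -surjective_pairing.
by rewrite /= lprojZ tpureZl.
Qed.

Lemma tens_univ (W : lmodType K) (f : M -> N -> W) :
    (forall y, linear (f^~ y)) -> (forall x, linear (f x)) ->
  exists F : {linear tens -> W}, forall x y, F (tpure x y) = f x y.
Proof.
move=> fl fr; pose F0 (g : {malg K[(M * N)%type]}) : W :=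
  \sum_(k <- msupp g) g@_k *: f k.1 k.2.
have F0w (d : {fset (M * N)%type}) g : (msupp g `<=` d)%fset ->
    F0 g = \sum_(k <- d) g@_k *: f k.1 k.2.
  move=> le; rewrite /F0 (big_fset_incl _ le) //= => k _ /mcoeff_outdom ->.
  by rewrite scale0r.
have F0P : linear F0.
  move=> a g h; set d := (msupp g `|` msupp h)%fset.
  have dg : (msupp g `<=` d)%fset by apply: fsubsetUl.
  have dh : (msupp h `<=` d)%fset by apply: fsubsetUr.
  have dgh : (msupp (a *: g + h) `<=` d)%fset.
    by apply: fsubset_trans (msuppD_le _ _) _; apply: fsetSU; apply: msuppZ_le.
  rewrite !(F0w d) // scaler_sumr -big_split; apply: eq_bigr => k _ /=.
  by rewrite mcoeffD mcoeffZ scalerDl scalerA.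
pose F1 := HB.pack F0 (GRing.isLinear.Build _ _ _ _ F0 F0P)
  : {linear {malg K[(M * N)%type]} -> W}.
have F1sym x y : F1 (sym x y) = f x y.
  rewrite /= /F0 tens_symE msuppU oner_eq0 big_seq_fset1 mcoeffUU.
  exact: scale1r.
have F1span g : lspan tens_rel g -> F1 g = 0.
  elim=> [_ [a x x' y|a x y y']||a u v _ u0 _ v0]; last 2 first.
  - exact: linear0.
  - by rewrite linearP u0 v0 scaler0 addr0.
  - by rewrite linearB linearP !F1sym (fl y a x x') subrr.
  - by rewrite linearB linearP !F1sym (fr x a y y') subrr.
pose F (t : tens) : W := F1 (repr t).
have FE g : F (lproj tens_rel g) = F1 g.
  by apply/eqP; rewrite -subr_eq0 -linearB F1span //; apply/lproj_eqP/lproj_repr.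
have FP : linear F.
  move=> a u v; rewrite -[u in LHS]lproj_repr -[v in LHS]lproj_repr.
  by rewrite -linearP FE linearP.
exists (HB.pack F (GRing.isLinear.Build _ _ _ _ F FP) : {linear tens -> W}).
by move=> x y; rewrite /= FE.
Qed.

End TensorProduct.

Notation "x ⊗ y" := (tpure x y) (at level 38, left associativity) : ring_scope.

Section Gradings.
Context (K : comNzRingType).

Definition sgn (k : int) : K := (-1) ^+ `|k|%N.

Section Module.
Context (V : lmodType K) (G : int -> V -> Prop).

Definition homogeneous (v : V) : Prop := exists p, G p v.

Definition homog_spanned : Prop := forall v, exists s : seq V,
  v = \sum_(u <- s) u /\ forall u, u \in s -> homogeneous u.

(* [G p] is the degree [p] summand of an internal direct sum decomposition. *)
Record is_grading : Prop := {
  grading0 : forall p, G p 0;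
  gradingP : forall p a u v, G p u -> G p v -> G p (a *: u + v);
  grading_sum : homog_spanned;
  grading_direct : forall (r : seq int) (f : int -> V),
    uniq r -> (forall p, G p (f p)) -> \sum_(p <- r) f p = 0 ->
    forall p, p \in r -> f p = 0 }.

(* The degree of a homogeneous element. It is arbitrary at 0, where it will
   only occur in signs multiplying a term that vanishes. *)
Definition deg (v : V) : int := xget 0 [set p | G p v].

(* Chosen homogeneous elements with sum [v]. *)
Definition hparts (v : V) : seq V :=
  xget [::] [set s | v = \sum_(u <- s) u /\ forall u, u \in s -> homogeneous u].

Lemma hpartsP (v : V) : homog_spanned ->
  v = \sum_(u <- hparts v) u /\ forall u, u \in hparts v -> homogeneous u.
Proof.
by rewrite /hparts => /(_ v) [s sP]; case: xgetP => [? _ //|/(_ s)].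
Qed.

End Module.

Section Tensor.
Context (M N : lmodType K) (G : int -> M -> Prop) (H : int -> N -> Prop).

Definition tens_homog (p : int) (t : tens M N) : Prop :=
  exists s : seq (M * N), t = \sum_(i <- s) i.1 ⊗ i.2 /\
    forall i, i \in s -> exists q r, [/\ G q i.1, H r i.2 & q + r = p].

(* A chosen expression of [t] as a sum of tensors of homogeneous elements.
   Sums over [hrep t] of multilinear expressions do not depend on the choice. *)
Definition hrep (t : tens M N) : seq (M * N) :=
  xget [::] [set s | t = \sum_(i <- s) i.1 ⊗ i.2 /\
    forall i, i \in s -> homogeneous G i.1 /\ homogeneous H i.2].

Lemma hrepP (t : tens M N) : homog_spanned G -> homog_spanned H ->
  t = \sum_(i <- hrep t) i.1 ⊗ i.2 /\
  forall i, i \in hrep t -> homogeneous G i.1 /\ homogeneous H i.2.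
Proof.
rewrite /hrep => grG grH; case: xgetP => [s _ //|noS].
pose P t' := exists s : seq (M * N), t' = \sum_(i <- s) i.1 ⊗ i.2 /\
  forall i, i \in s -> homogeneous G i.1 /\ homogeneous H i.2.
suff [s Ps] : P t by case: (noS s).
have P0 : P 0 by exists [::]; rewrite big_nil.
have PD u v : P u -> P v -> P (u + v).
  move=> [s [-> hs]] [s' [-> hs']]; exists (s ++ s'); rewrite big_cat; split=> //.
  by move=> i; rewrite mem_cat => /orP[/hs|/hs'].
have [s ->] := tens_sumP t.
apply: (big_ind _ P0 PD) => -[x y] _ /=.
have [xE hx] := hpartsP x grG; rewrite {1}xE tpure_suml big_seq.
apply: (big_ind _ P0 PD) => u /(hx u) hu.
have [yE hy] := hpartsP y grH; rewrite {1}yE raddf_sum big_seq.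
apply: (big_ind _ P0 PD) => v /(hy v) hv.
exists [:: (u, v)]; rewrite big_seq1; split=> // i.
by rewrite inE => /eqP ->.
Qed.

End Tensor.

Record graded_algebra (R : algType K) (G : int -> R -> Prop) : Prop := {
  graded_grading : is_grading G;
  graded1 : G 0 1;
  gradedM : forall p q x y, G p x -> G q y -> G (p + q) (x * y) }.

Definition tens_mul (R S : algType K) (G : int -> R -> Prop)
    (H : int -> S -> Prop) (s t : tens R S) : tens R S :=
  \sum_(i <- hrep G H s) \sum_(j <- hrep G H t)
    sgn (deg H i.2 * deg G j.1) *: ((i.1 * j.1) ⊗ (i.2 * j.2)).

Section HopfAxioms.
Context (A : algType K) (G : int -> A -> Prop).
Context (Delta : A -> tens A A) (eps : A -> K) (s : A -> A).

Local Notation sw x := (hrep G G (Delta x)).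

Record hopf_axioms : Prop := {
  comul_linear : linear Delta;
  comul_homog : forall p x, G p x -> tens_homog G G p (Delta x);
  comul1 : Delta 1 = 1 ⊗ 1;
  comulM : forall x y, Delta (x * y) = tens_mul G G (Delta x) (Delta y);
  comulA : forall x,
    \sum_(u <- sw x) \sum_(v <- sw u.1) v.1 ⊗ (v.2 ⊗ u.2) =
    \sum_(u <- sw x) \sum_(v <- sw u.2) u.1 ⊗ (v.1 ⊗ v.2);
  counit_linear : scalar eps;
  counit_homog : forall p x, G p x -> p != 0 -> eps x = 0;
  counit1 : eps 1 = 1;
  counitM : forall x y, eps (x * y) = eps x * eps y;
  counit_left : forall x, \sum_(u <- sw x) eps u.1 *: u.2 = x;
  counit_right : forall x, \sum_(u <- sw x) eps u.2 *: u.1 = x;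
  antipode_linear : linear s;
  antipode_homog : forall p x, G p x -> G p (s x);
  antipode_left : forall x, \sum_(u <- sw x) s u.1 * u.2 = (eps x)%:A;
  antipode_right : forall x, \sum_(u <- sw x) u.1 * s u.2 = (eps x)%:A }.

End HopfAxioms.
End Gradings.

HB.mixin Record isGradedHopf (K : comNzRingType) A of GRing.Algebra K A := {
  homog : int -> A -> Prop;
  comul : A -> tens A A;
  counit : A -> K;
  antipode : A -> A;
  homog_graded : graded_algebra homog;
  comul_hopf : hopf_axioms homog comul counit antipode }.

#[short(type="gradedHopfType")]
HB.structure Definition GradedHopf (K : comNzRingType) :=
  { A of isGradedHopf K A & GRing.Algebra K A }.

Section Sweedler.
Context (K : comNzRingType) (A : gradedHopfType K).

HB.instance Definition _ := GRing.isLinear.Build K A (tens A A) _ (@comul K A)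
  (comul_linear comul_hopf).
HB.instance Definition _ := GRing.isLinear.Build K A A _ (@antipode K A)
  (antipode_linear comul_hopf).
HB.instance Definition _ := GRing.isLinear.Build K A K _ (@counit K A)
  (counit_linear comul_hopf).

Fact counit_is_monoid_morphism : monoid_morphism (@counit K A).
Proof. by split; [exact: counit1 comul_hopf | exact: counitM comul_hopf]. Qed.

HB.instance Definition _ := GRing.isMonoidMorphism.Build A K (@counit K A)
  counit_is_monoid_morphism.

(* Sweedler notation: [sw2 x] lists the pairs (x', x''), [sw3 x] the triples
   (x', x'', x''') and [sw4 x] the quadruples (x^(1), ..., x^(4)), with
   homogeneous components; summation over the list is implicit on paper. *)
Definition sw2 (x : A) : seq (A * A) := hrep homog homog (comul x).

Definition sw3 (x : A) : seq (A * A * A) :=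
  [seq (u.1, v.1, v.2) | u <- sw2 x, v <- sw2 u.2].

Definition sw4 (x : A) : seq (A * A * A * A) :=
  [seq (u.1, v.1.1, v.1.2, v.2) | u <- sw2 x, v <- sw3 u.2].

End Sweedler.

Notation "\sw2_ ( a , b <- x ) E" :=
  (\sum_(u <- sw2 x) (let: (a, b) := u in E))
  (at level 41, E at level 41, a name, b name) : ring_scope.
Notation "\sw3_ ( a , b , c <- x ) E" :=
  (\sum_(u <- sw3 x) (let: (a, b, c) := u in E))
  (at level 41, E at level 41, a name, b name, c name) : ring_scope.
Notation "\sw4_ ( a , b , c , d <- x ) E" :=
  (\sum_(u <- sw4 x) (let: (a, b, c, d) := u in E))
  (at level 41, E at level 41, a name, b name, c name, d name) : ring_scope.

Section HopfTheory.
Context (K : comNzRingType) (A : gradedHopfType K).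

Definition ungraded : Prop := forall p (x : A), p != 0 -> homog p x -> x = 0.

Definition graded_commutative : Prop := forall p q (x y : A),
  homog p x -> homog q y -> x * y = sgn K (p * q) *: (y * x).

Definition graded_cocommutative : Prop := forall x : A,
  comul x =
  \sw2_(x1, x2 <- x) sgn K (deg homog x1 * deg homog x2) *: (x2 ⊗ x1).

Definition cosymmetric (b : A) : Prop :=
  \sw2_(b1, b2 <- b) b1 ⊗ b2 = \sw2_(b1, b2 <- b) b2 ⊗ b1.

Record Fox_pairing (n : int) (rho : A -> A -> A) : Prop := {
  Fox_linearl : forall y, linear (rho^~ y);
  Fox_linearr : forall x, linear (rho x);
  Fox_homog : forall p q x y,
    homog p x -> homog q y -> homog (p + q + n) (rho x y);
  Fox_mulr : forall x y z,
    rho x (y * z) = rho x y * z + counit y *: rho x z;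
  Fox_mull : forall x y z,
    rho (x * y) z = counit y *: rho x z + x * rho y z }.

Definition Fox_antisymmetric (n : int) (rho : A -> A -> A) : Prop :=
  exists sinv : A -> A,
    [/\ cancel antipode sinv, cancel sinv antipode &
     forall p q x y, homog p x -> homog q y ->
       sgn K ((p + n) * (q + n)) *: sinv (rho (antipode y) (antipode x)) =
       - rho x y].

Record biderivation (bul : A -> A -> K) : Prop := {
  bider_linearl : forall c, scalar (bul^~ c);
  bider_linearr : forall b, scalar (bul b);
  bider_mull : forall b c d,
    bul (b * c) d = counit b * bul c d + counit c * bul b d;
  bider_mulr : forall b c d,
    bul b (c * d) = counit c * bul b d + counit d * bul b c }.

Definition balanced (bul : A -> A -> K) : Prop := forall b c : A,
  \sw3_(c1, c2, c3 <- c) bul b c2 *: (antipode c1 * c3) =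
  \sw3_(b1, b2, b3 <- b) bul c b2 *: (antipode b3 * b1).

(* The signs are those of the homogeneous case, extended bilinearly. *)
Definition adl (y z : A) : A :=
  \sum_(z0 <- hparts homog z) \sw2_(y1, y2 <- y)
    sgn K (deg homog z0 * deg homog y2) *: (y1 * z0 * antipode y2).

Definition adr (z y : A) : A :=
  \sum_(z0 <- hparts homog z) \sw2_(y1, y2 <- y)
    sgn K (deg homog z0 * deg homog y1) *: (antipode y1 * z0 * y2).

Definition commutator_rel (w : A) : Prop := exists p q y z,
  [/\ homog p y, homog q z & w = y * z - sgn K (p * q) *: (z * y)].

Definition comm_quot : Type := lquot commutator_rel.
HB.instance Definition _ := GRing.Lmodule.on comm_quot.
Definition comm_cls : A -> comm_quot := @lproj K A commutator_rel.

(* The tensor product over [A] of [A] with the right action [adr] and [A] with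
   the left action [adl]. *)
Definition ad_rel (t : tens A A) : Prop :=
  exists x a y, t = adr x a ⊗ y - x ⊗ adl a y.

Definition adtens : Type := lquot ad_rel.
HB.instance Definition _ := GRing.Lmodule.on adtens.
Definition adpure (x y : A) : adtens := lproj ad_rel (x ⊗ y).

(* Defined on [repr u] and [repr v], the chosen representatives of the classes
   [u] and [v]; for a Fox pairing [rho] in a cocommutative Hopf algebra the
   value does not depend on this choice. *)
Definition Theta (rho : A -> A -> A) (u v : comm_quot) : adtens :=
  \sw2_(x1, x2 <- (repr u)) \sw2_(y1, y2 <- (repr v))
    adpure (adr x1 (rho x2 y1)) y2.

End HopfTheory.

Section RepresentationAlgebra.
Context (K : comNzRingType) (A B : gradedHopfType K).

Definition rep_sym (x : A) (b : B) : free_alg K (A * B)%type := fvar K (x, b).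
Local Notation sym := rep_sym.

Inductive rep_rel : free_alg K (A * B)%type -> Prop :=
| rep_linearl a x y b :
    rep_rel (sym (a *: x + y) b - (a *: sym x b + sym y b))
| rep_linearr a x b c :
    rep_rel (sym x (a *: b + c) - (a *: sym x b + sym x c))
| rep_mull x y b :
    rep_rel (sym (x * y) b - \sw2_(b1, b2 <- b) sym x b1 * sym y b2)
| rep_1l b : rep_rel (sym 1 b - (counit b)%:A)
| rep_mulr x b c :
    rep_rel (sym x (b * c) - \sw2_(x1, x2 <- x) sym x1 b * sym x2 c)
| rep_1r x : rep_rel (sym x 1 - (counit x)%:A)
| rep_comm p q r s x b y c :
    homog p x -> homog q b -> homog r y -> homog s c ->
    rep_rel (sym x b * sym y c
             - sgn K ((p + q) * (r + s)) *: (sym y c * sym x b)).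

Definition repalg : Type := aquot rep_rel.
HB.instance Definition _ := GRing.Lmodule.on repalg.
HB.instance Definition _ := GRing.PzRing.on repalg.

(* The generator x_b of A_B. *)
Definition gen (x : A) (b : B) : repalg := aproj rep_rel (sym x b).

Let aug_word (w : {fmonom (A * B)%type}) : K :=
  \prod_(i <- (w : seq (A * B)%type)) (counit i.1 * counit i.2).

Fact aug_word_mmorphism : mmorphism aug_word.
Proof.
by split=> [v w|]; rewrite /aug_word ?fmM ?big_cat // fm1 big_nil.
Qed.

HB.instance Definition _ := monalg.isMultiplicative.Build
  {fmonom (A * B)%type} K aug_word aug_word_mmorphism.

Let aug : free_alg K (A * B)%type -> K := mmap idfun aug_word.

HB.instance Definition _ := GRing.RMorphism.on aug.

Let augZ a f : aug (a *: f) = a * aug f.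
Proof. exact: (mmap_is_linear (h := aug_word)). Qed.

Let augM f g : aug (f * g) = aug f * aug g.
Proof. exact: rmorphM. Qed.

Let aug1 : aug 1 = 1.
Proof. exact: rmorph1. Qed.

Let aug_sym x b : aug (sym x b) = counit x * counit b.
Proof. by rewrite /aug /rep_sym fvarE mmapU /= mul1r /aug_word fmU big_seq1. Qed.

Let sw_counit (H : gradedHopfType K) (x : H) :
  \sw2_(x1, x2 <- x) (counit x1 * counit x2) = counit x.
Proof.
rewrite -[in RHS](counit_left comul_hopf x) raddf_sum.
by apply: eq_bigr => -[x1 x2] _ /=; rewrite linearZ.
Qed.

Let aug_rep_rel f : rep_rel f -> aug f = 0.
Proof.
case=> [a x y b|a x b c|x y b|b|x b c|x|p q r s x b y c hx hb hy hc];
  apply/eqP; rewrite raddfB subr_eq0 /=; apply/eqP.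
- by rewrite raddfD /= augZ !aug_sym (counit_linear comul_hopf) mulrDl mulrA.
- by rewrite raddfD /= augZ !aug_sym (counit_linear comul_hopf) mulrDr mulrCA.
- rewrite aug_sym (counitM comul_hopf) raddf_sum /= -(sw_counit b) mulr_sumr.
  by apply: eq_bigr => -[b1 b2] _; rewrite rmorphM /= !aug_sym mulrACA.
- by rewrite aug_sym (counit1 comul_hopf) mul1r augZ aug1 mulr1.
- rewrite aug_sym (counitM comul_hopf) raddf_sum /= -(sw_counit x) mulr_suml.
  by apply: eq_bigr => -[x1 x2] _; rewrite rmorphM /= !aug_sym mulrACA.
- by rewrite aug_sym (counit1 comul_hopf) mulr1 augZ aug1 mulr1.
have h0 (H : gradedHopfType K) k (z : H) : homog k z -> k = 0 \/ counit z = 0.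
  move=> hz; have [->|k0] := eqVneq k 0; first by left.
  by right; apply: (counit_homog comul_hopf) k0.
have augMs x1 x2 b1 b2 : aug (sym x1 b1 * sym x2 b2) =
    counit x1 * counit b1 * (counit x2 * counit b2).
  exact: etrans (augM _ _) (congr2 *%R (aug_sym _ _) (aug_sym _ _)).
apply: etrans (augMs _ _ _ _) _; apply/esym; apply: etrans (augZ _ _) _.
apply: etrans (congr1 _ (augMs _ _ _ _)) _.
have [->|->] := h0 _ _ _ hx; last by rewrite !(mul0r, mulr0).
have [->|->] := h0 _ _ _ hb; last by rewrite !(mul0r, mulr0).
by rewrite addr0 mul0r mul1r mulrC.
Qed.

Fact repalg_oner_neq0 : 1 != 0 :> repalg.
Proof.
apply/eqP => e.
have {e} : lproj (ideal_gen rep_rel) 1 = lproj (ideal_gen rep_rel) 0.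
  by rewrite raddf0; exact: e.
move=> /lproj_eqP; rewrite subr0 => h.
suff /eqP : aug 1 = 0 by rewrite aug1 oner_eq0.
elim: h => [_ [u [s [v [/aug_rep_rel s0 ->]]]]||a u v _ u0 _ v0].
- by rewrite !rmorphM /= s0 mulr0 mul0r.
- exact: raddf0.
- by rewrite raddfD /= augZ u0 v0 mulr0 addr0.
Qed.

HB.instance Definition _ := GRing.PzSemiRing_isNonZero.Build repalg
  repalg_oner_neq0.
HB.instance Definition _ := GRing.Lmodule_isLalgebra.Build K repalg
  (@aquot_scaleAl K _ rep_rel).
HB.instance Definition _ := GRing.Lalgebra_isAlgebra.Build K repalg
  (@aquot_scaleAr K _ rep_rel).

(* The grading of A_B with |x_b| = |x| + |b|. *)
Inductive repalg_homog : int -> repalg -> Prop :=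
| repalg_homog_gen p q x b :
    homog p x -> homog q b -> repalg_homog (p + q) (gen x b)
| repalg_homog0 p : repalg_homog p 0
| repalg_homog1 : repalg_homog 0 1
| repalg_homogP p a u v :
    repalg_homog p u -> repalg_homog p v -> repalg_homog p (a *: u + v)
| repalg_homogM p q u v :
    repalg_homog p u -> repalg_homog q v -> repalg_homog (p + q) (u * v).

Lemma rep_relP f : rep_rel f -> aproj rep_rel f = 0.
Proof.
move=> hf; rewrite -(raddf0 (aproj rep_rel)); apply/lproj_eqP/lspan_gen.
by exists 1, f, 1; rewrite mulr1 mul1r subr0.
Qed.

Lemma rep_rel_eq f g : rep_rel (f - g) -> aproj rep_rel f = aproj rep_rel g.
Proof. by move/rep_relP/eqP; rewrite raddfB subr_eq0 => /eqP. Qed.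

Lemma gen_linearl b : linear (gen^~ b).
Proof.
move=> a x y; apply: etrans (rep_rel_eq (rep_linearl a x y b)) _.
by apply: etrans (raddfD _ _ _) _; congr (_ + _); apply: aprojZ.
Qed.

Lemma gen_linearr x : linear (gen x).
Proof.
move=> a b c; apply: etrans (rep_rel_eq (rep_linearr a x b c)) _.
by apply: etrans (raddfD _ _ _) _; congr (_ + _); apply: aprojZ.
Qed.

Lemma gen_mull x y b :
  gen (x * y) b = \sw2_(b1, b2 <- b) gen x b1 * gen y b2.
Proof.
apply: etrans (rep_rel_eq (rep_mull x y b)) _.
apply: etrans (raddf_sum _ _ _ _) _.
by apply: eq_bigr => -[b1 b2] _; apply: aprojMr.
Qed.

Lemma gen_mulr x b c :
  gen x (b * c) = \sw2_(x1, x2 <- x) gen x1 b * gen x2 c.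
Proof.
apply: etrans (rep_rel_eq (rep_mulr x b c)) _.
apply: etrans (raddf_sum _ _ _ _) _.
by apply: eq_bigr => -[x1 x2] _; apply: aprojMr.
Qed.

Lemma gen_1l b : gen 1 b = (counit b)%:A.
Proof. by apply: etrans (rep_rel_eq (rep_1l b)) _; apply: aprojZ. Qed.

Lemma gen_1r x : gen x 1 = (counit x)%:A.
Proof. by apply: etrans (rep_rel_eq (rep_1r x)) _; apply: aprojZ. Qed.

Lemma gen_comm p q r s x b y c :
  homog p x -> homog q b -> homog r y -> homog s c ->
  gen x b * gen y c = sgn K ((p + q) * (r + s)) *: (gen y c * gen x b).
Proof.
move=> hx hb hy hc; apply: etrans (esym (aprojMr _ _ _)) _.
apply: etrans (rep_rel_eq (rep_comm hx hb hy hc)) _.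
by apply: etrans (aprojZ _ _ _) _; congr (_ *: _); apply: aprojMr.
Qed.

Lemma repalg_spanned : homog_spanned repalg_homog.
Proof.
pose P m := exists s : seq repalg, m = \sum_(u <- s) u /\
  forall u, u \in s -> homogeneous repalg_homog u.
have PH m : homogeneous repalg_homog m -> P m.
  by move=> hm; exists [:: m]; rewrite big_seq1; split=> // u; rewrite inE => /eqP ->.
have P0 : P 0 by exists [::]; rewrite big_nil.
have PD u v : P u -> P v -> P (u + v).
  move=> [s [-> hs]] [s' [-> hs']]; exists (s ++ s'); rewrite big_cat; split=> //.
  by move=> i; rewrite mem_cat => /orP[/hs|/hs'].
have PZ a u : P u -> P (a *: u).
  move=> [s [-> hs]]; rewrite scaler_sumr big_seq.
  apply: (big_ind _ P0 PD) => v /hs [p hv]; apply: PH; exists p.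
  by rewrite -[_ *: _]addr0; apply: repalg_homogP => //; apply: repalg_homog0.
have PM u v : P u -> P v -> P (u * v).
  move=> [s [-> hs]] [s' [-> hs']]; rewrite mulr_suml big_seq.
  apply: (big_ind _ P0 PD) => {}u /hs [p hu]; rewrite mulr_sumr big_seq.
  apply: (big_ind _ P0 PD) => {}v /hs' [q hv]; apply: PH; exists (p + q).
  exact: repalg_homogM.
have P1 : P 1 by apply: PH; exists 0; apply: repalg_homog1.
have Pgen x b : P (gen x b).
  have [xE hx] := hpartsP x (grading_sum (graded_grading homog_graded)).
  have [bE hb] := hpartsP b (grading_sum (graded_grading homog_graded)).
  have D y y' : gen (y + y') b = gen y b + gen y' b.
    by rewrite -[y in LHS]scale1r gen_linearl scale1r.
  have Z : gen 0 b = 0.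
    by have := gen_linearl b (-1) 0 0; rewrite scaler0 addr0 scaleN1r addNr.
  rewrite {1}xE (big_morph (gen^~ b) D Z) big_seq.
  apply: (big_ind _ P0 PD) => y /(hx y) [p hy].
  have D' c c' : gen y (c + c') = gen y c + gen y c'.
    by rewrite -[c in LHS]scale1r gen_linearr scale1r.
  have Z' : gen y 0 = 0.
    by have := gen_linearr y (-1) 0 0; rewrite scaler0 addr0 scaleN1r addNr.
  rewrite {1}bE (big_morph (gen y) D' Z') big_seq.
  apply: (big_ind _ P0 PD) => c /(hb c) [q hc]; apply: PH; exists (p + q).
  exact: repalg_homog_gen.
move=> m; rewrite -/(P m) -[m]aproj_repr.
rewrite (_ : repr m = \sum_(k <- msupp (repr m)) (repr m)@_k *: << k >>); last first.
  rewrite [LHS]monalgE; apply: eq_bigr => k _.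
  by rewrite malg_scaleU mulr1.
rewrite raddf_sum /=; apply: (big_ind _ P0 PD) => k _.
rewrite aprojZ; apply: PZ; case: k => w.
elim: w => [|[x b] w IH].
  by rewrite -fmoneE; apply: P1.
rewrite (_ : << _ >> = sym x b * << FMonom w >>).
  by rewrite aprojMr; apply: PM; [exact: Pgen | exact: IH].
rewrite /rep_sym fvarE malgM_def fgmulUU mulr1; congr << _ >>.
by rewrite /mmul /= fmuE fmmulE.
Qed.

(* The map (b ⌣ c): defined on a chosen expression of [t] as a sum of pure tensors; for
   cosymmetric [b], [c] and a balanced biderivation [bul] the value does not
   depend on this choice. *)
Definition smile (bul : B -> B -> K) (b c : B) (t : adtens A) : repalg :=
  \sum_(i <- hrep homog homog (repr t)) \sw2_(b1, b2 <- b) \sw2_(c1, c2 <- c)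
    bul b1 c1 *: (gen i.1 b2 * gen i.2 c2).

Local Notation sw_coaction D m := (hrep repalg_homog homog (D m)).

Record canonical_coaction (D : repalg -> tens repalg B) : Prop := {
  coact_linear : linear D;
  coact_homog : forall p m,
    repalg_homog p m -> tens_homog repalg_homog homog p (D m);
  coact1 : D 1 = 1 ⊗ 1;
  coactM : forall m m', D (m * m') = tens_mul repalg_homog homog (D m) (D m');
  coactA : forall m,
    \sum_(u <- sw_coaction D m) \sum_(v <- sw_coaction D u.1)
      v.1 ⊗ (v.2 ⊗ u.2) =
    \sum_(u <- sw_coaction D m) \sw2_(b1, b2 <- u.2) u.1 ⊗ (b1 ⊗ b2);
  coact_counit : forall m,
    \sum_(u <- sw_coaction D m) counit u.2 *: u.1 = m;
  coact_gen : forall x b,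
    D (gen x b) = \sw3_(b1, b2, b3 <- b) gen x b2 ⊗ (antipode b1 * b3) }.

Definition coinvariant (D : repalg -> tens repalg B) (m : repalg) : Prop :=
  D m = m ⊗ 1.

End RepresentationAlgebra.

Record graded_bracket (K : comNzRingType) (R : algType K)
    (G : int -> R -> Prop) (n : int) (br : R -> R -> R) : Prop := {
  br_linearl : forall y, linear (br^~ y);
  br_linearr : forall x, linear (br x);
  br_homog : forall p q x y, G p x -> G q y -> G (p + q + n) (br x y);
  br_mulr : forall p q x y z, G p x -> G q y ->
    br x (y * z) = br x y * z + sgn K ((p + n) * q) *: (y * br x z);
  br_mull : forall q r x y z, G q y -> G r z ->
    br (x * y) z = x * br y z + sgn K (q * (r + n)) *: (br x z * y) }.

(* Main.v *)
From HB Require Import structures.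
From mathcomp Require Import all_boot all_algebra.
From mathcomp Require Import boolp classical_sets zify.
Require Import Defs.

(** Write [S x y] for the value of the map (b smile c) on a pure tensor,
    the sum of (b' . c') x_(b'') y_(c'').  The product rules of A_B, the rule
    s(a)_b = a_(s b) and graded commutativity turn the adjoint actions into
    single generators:
      S (ad^r(x, a)) y = (b1 . c1) x_(b3) a_(s(b2) b4) y_(c2),
      S x (ad^l(a, y)) = (b1 . c1) x_(b2) a_(c2 s(c4)) y_(c3),
    where the signs of the adjoint actions are exactly those created by moving
    generators past each other.  Everything then rests on one exchange
    identity in B ([balanced_exchange]): for cosymmetric [b] and [c] and every
    trilinear P,
      (b1 . c1) P(b3, s(b2) b4, c2) = (b1 . c1) P(b2, c2 s(c4), c3).
    Cosymmetry makes iterated coproducts of [b] and [c] invariant under cyclic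
    rotation; rotating [b] brings the left side to the form in which the
    balancing axiom moves the factor s(-)(-) from [b] to [c]; rotating [c],
    swapping the two components of [b] and using commutativity of B gives the
    right side.

    The identity is used twice.
    - With P(u, w, v) = x_u a_w y_v it says that S is middle linear for the
      adjoint actions, so (b smile c) is computed on any expression of its
      argument by pure tensors ([smile_adpure_sum]).
    - With P(u, w, v) the sum of x_u y_(v'') (x) w s(v') v''', the left side
      is the coaction of S x y, while on the right side two pairs of antipode
      factors cancel and leave (S x y) (x) 1.  Hence the image of (b smile c)
      is coinvariant ([coaction_smile_pure]).

    The formula defining the bracket is, after applying cocommutativity of A
    to [x], rotating [b] and swapping the two components of [c], the first of
    the two displayed formulas for S, with rho(x'', y') in the role of [a]
    ([bracket_formula_smile]).

    Finally x_b depends only on the class of [x] modulo graded commutators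
    when [b] is cosymmetric, so [x] and [y] may be replaced by the
    representatives on which Theta is evaluated. *)

Set Implicit Arguments.
Unset Strict Implicit.
Unset Printing Implicit Defensive.

Import GRing.Theory.
Local Open Scope ring_scope.

(** * Multilinear maps and tensors *)

Section MultilinearMaps.
Context (K : comNzRingType).
Implicit Types U V W M N P Q : lmodType K.

Definition bilinear_map M N V (f : M -> N -> V) : Prop :=
  (forall y, linear (f^~ y)) /\ (forall x, linear (f x)).

Definition trilinear_map M N P V (f : M -> N -> P -> V) : Prop :=
  (forall z, bilinear_map (fun x y => f x y z)) /\
  (forall x y, linear (f x y)).

Definition quadrilinear_map M N P U V (f : M -> N -> P -> U -> V) : Prop :=
  (forall t, trilinear_map (fun x y z => f x y z t)) /\
  (forall x y z, linear (f x y z)).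

Section LinearProp.
Context (U V : lmodType K) (f : U -> V) (f_lin : linear f).

Lemma lin0 : f 0 = 0.
Proof. by have := f_lin (-1) 0 0; rewrite scaler0 addr0 scaleN1r addNr. Qed.

Lemma linD : {morph f : x y / x + y}.
Proof. by move=> x y; rewrite -[x in LHS]scale1r f_lin scale1r. Qed.

Lemma linZ a : {morph f : x / a *: x}.
Proof. by move=> x; rewrite -[a *: x]addr0 f_lin lin0 addr0. Qed.

Lemma linB : {morph f : x y / x - y}.
Proof. by move=> x y; rewrite linD -scaleN1r linZ scaleN1r. Qed.

Lemma lin_sumE (I : Type) (r : seq I) (F : I -> U) :
  f (\sum_(i <- r) F i) = \sum_(i <- r) f (F i).
Proof. exact: (big_morph f linD lin0). Qed.

End LinearProp.

Lemma linear_id U : linear (fun x : U => x).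
Proof. by []. Qed.

Lemma linear_big_sum U V (I : Type) (r : seq I) (F : I -> U -> V) :
  (forall i, linear (F i)) -> linear (fun x => \sum_(i <- r) F i x).
Proof.
move=> F_lin a x y; rewrite scaler_sumr -big_split.
by apply: eq_bigr => i _; rewrite F_lin.
Qed.

Lemma linear_comp_map U V W (g : V -> W) (f : U -> V) :
  linear g -> linear f -> linear (fun x => g (f x)).
Proof. by move=> g_lin f_lin a x y; rewrite f_lin g_lin. Qed.

Lemma linear_scale U V (a : K) (f : U -> V) :
  linear f -> linear (fun x => a *: f x).
Proof.
by move=> f_lin c x y; rewrite f_lin scalerDr !scalerA mulrC.
Qed.

Lemma linear_scalel U V (f : U -> K) (v : V) :
  scalar f -> linear (fun x => f x *: v).
Proof. by move=> f_lin c x y; rewrite f_lin scalerDl scalerA. Qed.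

Lemma linear_mull U (R : algType K) (r : R) (f : U -> R) :
  linear f -> linear (fun x => f x * r).
Proof. by move=> f_lin c x y; rewrite f_lin mulrDl scalerAl. Qed.

Lemma linear_mulr U (R : algType K) (r : R) (f : U -> R) :
  linear f -> linear (fun x => r * f x).
Proof. by move=> f_lin c x y; rewrite f_lin mulrDr scalerAr. Qed.

Lemma linear_tpurel U M N (f : U -> M) (y : N) :
  linear f -> linear (fun x => f x ⊗ y).
Proof. by move=> f_lin a x x'; rewrite f_lin tpure_linearl. Qed.

Lemma linear_tpurer U M N (f : U -> N) (x : M) :
  linear f -> linear (fun y => x ⊗ f y).
Proof. by move=> f_lin a y y'; rewrite f_lin tpure_linearr. Qed.

Lemma linear_bilinearl U M N V (f : M -> N -> V) (g : U -> M) y :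
  bilinear_map f -> linear g -> linear (fun u => f (g u) y).
Proof. by move=> [fl _]; apply: linear_comp_map (fl y). Qed.

Lemma linear_bilinearr U M N V (f : M -> N -> V) (g : U -> N) x :
  bilinear_map f -> linear g -> linear (fun u => f x (g u)).
Proof. by move=> [_ fr]; apply: linear_comp_map (fr x). Qed.

Lemma linear_trilinear1 U M N P V (f : M -> N -> P -> V) (g : U -> M) y z :
  trilinear_map f -> linear g -> linear (fun u => f (g u) y z).
Proof. by move=> [f12 _]; apply: linear_comp_map ((f12 z).1 y). Qed.

Lemma linear_trilinear2 U M N P V (f : M -> N -> P -> V) (g : U -> N) x z :
  trilinear_map f -> linear g -> linear (fun u => f x (g u) z).
Proof. by move=> [f12 _]; apply: linear_comp_map ((f12 z).2 x). Qed.

Lemma linear_trilinear3 U M N P V (f : M -> N -> P -> V) (g : U -> P) x y :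
  trilinear_map f -> linear g -> linear (fun u => f x y (g u)).
Proof. by move=> [_ f3]; apply: linear_comp_map (f3 x y). Qed.

Lemma linear_quadrilinear1 U M N P Q V (f : M -> N -> P -> Q -> V) (g : U -> M)
  y z t : quadrilinear_map f -> linear g -> linear (fun u => f (g u) y z t).
Proof. by move=> [f123 _]; apply: linear_comp_map (((f123 t).1 z).1 y). Qed.

Lemma linear_quadrilinear2 U M N P Q V (f : M -> N -> P -> Q -> V) (g : U -> N)
  x z t : quadrilinear_map f -> linear g -> linear (fun u => f x (g u) z t).
Proof. by move=> [f123 _]; apply: linear_comp_map (((f123 t).1 z).2 x). Qed.

Lemma linear_quadrilinear3 U M N P Q V (f : M -> N -> P -> Q -> V) (g : U -> P)
  x y t : quadrilinear_map f -> linear g -> linear (fun u => f x y (g u) t).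
Proof. by move=> [f123 _]; apply: linear_comp_map ((f123 t).2 x y). Qed.

Lemma linear_quadrilinear4 U M N P Q V (f : M -> N -> P -> Q -> V) (g : U -> Q)
  x y z : quadrilinear_map f -> linear g -> linear (fun u => f x y z (g u)).
Proof. by move=> [_ f4]; apply: linear_comp_map (f4 x y z). Qed.

(** The universal property of the tensor product in the form needed for
    chosen expressions: it removes the choice behind every Sweedler sum. *)
Lemma tens_sum_bilinear M N V (f : M -> N -> V) (r s : seq (M * N)) :
    bilinear_map f ->
    \sum_(i <- r) i.1 ⊗ i.2 = \sum_(i <- s) i.1 ⊗ i.2 ->
  \sum_(i <- r) f i.1 i.2 = \sum_(i <- s) f i.1 i.2.
Proof.
move=> [fl fr] rs; have [F FE] := tens_univ fl fr.
have FsE t : \sum_(i <- t) f i.1 i.2 = F (\sum_(i <- t) i.1 ⊗ i.2).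
  by rewrite raddf_sum; apply: eq_bigr => i _; rewrite /= FE.
by rewrite !FsE rs.
Qed.

(** The index types are arbitrary so that both sides can be nested Sweedler
    sums, as in coassociativity. *)
Lemma tens_sum_trilinear M N P V (f : M -> N -> P -> V) (I J : Type)
    (r : seq I) (s : seq J) (g : I -> M * N * P) (h : J -> M * N * P) :
    trilinear_map f ->
    \sum_(i <- r) (g i).1.1 ⊗ ((g i).1.2 ⊗ (g i).2) =
      \sum_(j <- s) (h j).1.1 ⊗ ((h j).1.2 ⊗ (h j).2) ->
  \sum_(i <- r) f (g i).1.1 (g i).1.2 (g i).2 =
    \sum_(j <- s) f (h j).1.1 (h j).1.2 (h j).2.
Proof.
move=> [f12 f3] rs.
have f1 y z := (f12 z).1 y; have f2 x z := (f12 z).2 x.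
have [F FE] : exists F : M -> tens N P -> V,
    bilinear_map F /\ forall x y z, F x (y ⊗ z) = f x y z.
  have lift x := boolp.cid (tens_univ (f2 x) (f3 x)).
  exists (fun x t => sval (lift x) t); split=> [|x y z]; last first.
    by case: (lift x) => F /= ->.
  split=> [t|x]; last exact: linearP.
  move=> a x y; case: (lift x) (lift y) (lift (a *: x + y)) => Fx FxE.
  move=> [Fy FyE] [Fxy FxyE] /=; have [l ->] := tens_sumP t.
  rewrite !raddf_sum -big_split; apply: eq_bigr => -[u v] _ /=.
  by rewrite FxE FyE FxyE f1.
move: FE => [F_bil FE].
have := @tens_sum_bilinear _ _ _ F
  [seq ((g i).1.1, (g i).1.2 ⊗ (g i).2) | i <- r]
  [seq ((h j).1.1, (h j).1.2 ⊗ (h j).2) | j <- s] F_bil.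
rewrite !big_map /= => /(_ rs) FF.
have FgE (I' : Type) (l : seq I') (k : I' -> M * N * P) :
    \sum_(i <- l) f (k i).1.1 (k i).1.2 (k i).2 =
    \sum_(i <- l) F (k i).1.1 ((k i).1.2 ⊗ (k i).2).
  by apply: eq_bigr => i _; rewrite FE.
by rewrite !FgE.
Qed.

End MultilinearMaps.

(** * Sweedler calculus *)

Section SweedlerCalculus.
Context (K : comNzRingType) (H : gradedHopfType K).
Implicit Types (V W : lmodType K) (x : H).

Lemma homog_spanned_hopf : homog_spanned (@homog K H).
Proof. exact: grading_sum (graded_grading homog_graded). Qed.

Lemma sw2P x : comul x = \sum_(u <- sw2 x) u.1 ⊗ u.2 /\
  forall u, u \in sw2 x -> homogeneous homog u.1 /\ homogeneous homog u.2.
Proof. exact: hrepP homog_spanned_hopf homog_spanned_hopf. Qed.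

Lemma sw3E V (f : H -> H -> H -> V) x :
  \sw3_(a, b, c <- x) f a b c = \sw2_(a, u <- x) \sw2_(b, c <- u) f a b c.
Proof.
rewrite /sw3 big_allpairs_dep; apply: eq_bigr => -[a u] _ /=.
by apply: eq_bigr => -[b c].
Qed.

Lemma sw4E V (f : H -> H -> H -> H -> V) x :
  \sw4_(a, b, c, d <- x) f a b c d =
  \sw2_(a, u <- x) \sw3_(b, c, d <- u) f a b c d.
Proof.
rewrite /sw4 big_allpairs_dep; apply: eq_bigr => -[a u] _ /=.
by apply: eq_bigr => -[[b c] d].
Qed.

(** A Sweedler sum of a bilinear expression may be computed on any expression
    of the coproduct, homogeneous or not. *)
Lemma sw2_rep V (f : H -> H -> V) x (r : seq (H * H)) :
    bilinear_map f -> comul x = \sum_(i <- r) i.1 ⊗ i.2 ->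
  \sw2_(a, b <- x) f a b = \sum_(i <- r) f i.1 i.2.
Proof.
move=> f_bil xr; rewrite -(tens_sum_bilinear (r := sw2 x) f_bil).
  by apply: eq_bigr => -[].
by rewrite -(sw2P x).1.
Qed.

Lemma linear_sw2 V (f : H -> H -> V) :
  bilinear_map f -> linear (fun x => \sw2_(a, b <- x) f a b).
Proof.
move=> f_bil a x y; have [fl fr] := f_bil.
rewrite (sw2_rep (r := [seq (a *: u.1, u.2) | u <- sw2 x] ++ sw2 y) f_bil).
  rewrite big_cat big_map scaler_sumr /=.
  congr (_ + _); apply: eq_bigr => -[u v] _ //=.
  exact: (linZ (fl v)).
rewrite (comul_linear comul_hopf) (sw2P x).1 (sw2P y).1 big_cat big_map.
rewrite scaler_sumr /=.
by congr (_ + _); apply: eq_bigr => u _; rewrite tpureZl.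
Qed.

Lemma sw2A V (f : H -> H -> H -> V) x : trilinear_map f ->
  \sw2_(u, c <- x) \sw2_(a, b <- u) f a b c =
  \sw2_(a, u <- x) \sw2_(b, c <- u) f a b c.
Proof.
move=> f_tri; pose r := [seq (u, v) | u <- sw2 x, v <- sw2 u.1].
pose s := [seq (u, v) | u <- sw2 x, v <- sw2 u.2].
have := @tens_sum_trilinear _ _ _ _ _ f _ _ r s
  (fun p => (p.2.1, p.2.2, p.1.2)) (fun p => (p.1.1, p.2.1, p.2.2)) f_tri.
rewrite !big_allpairs_dep /= => /(_ (comulA comul_hopf x)) rs.
etransitivity; [|etransitivity; [exact: rs|]];
  by apply: eq_bigr => -[u v] _ /=; apply: eq_bigr => -[].
Qed.

Lemma sw2_counitl V (f : H -> V) x :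
  linear f -> \sw2_(a, b <- x) counit a *: f b = f x.
Proof.
move=> f_lin; rewrite -[in RHS](counit_left comul_hopf x) (lin_sumE f_lin).
by apply: eq_bigr => -[a b] _; rewrite (linZ f_lin).
Qed.

Lemma sw2_counitr V (f : H -> V) x :
  linear f -> \sw2_(a, b <- x) counit b *: f a = f x.
Proof.
move=> f_lin; rewrite -[in RHS](counit_right comul_hopf x) (lin_sumE f_lin).
by apply: eq_bigr => -[a b] _; rewrite (linZ f_lin).
Qed.

Lemma sw2_antipodel V (f : H -> V) x :
  linear f -> \sw2_(a, b <- x) f (antipode a * b) = counit x *: f 1.
Proof.
move=> f_lin; rewrite -(linZ f_lin) -(antipode_left comul_hopf x).
by rewrite (lin_sumE f_lin); apply: eq_bigr => -[].
Qed.

Lemma sw2_antipoder V (f : H -> V) x :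
  linear f -> \sw2_(a, b <- x) f (a * antipode b) = counit x *: f 1.
Proof.
move=> f_lin; rewrite -(linZ f_lin) -(antipode_right comul_hopf x).
by rewrite (lin_sumE f_lin); apply: eq_bigr => -[].
Qed.

Lemma cosymmetric_sw2 V (f : H -> H -> V) x : cosymmetric x -> bilinear_map f ->
  \sw2_(a, b <- x) f a b = \sw2_(a, b <- x) f b a.
Proof.
move=> x_sym f_bil.
rewrite (sw2_rep (r := [seq (u.2, u.1) | u <- sw2 x]) f_bil).
  by rewrite big_map; apply: eq_bigr => -[].
rewrite (sw2P x).1 big_map.
by etransitivity; [|etransitivity; [exact: x_sym|]]; apply: eq_bigr => -[].
Qed.

Lemma cocommutative_sw2 V (f : H -> H -> V) x :
    graded_cocommutative H -> bilinear_map f ->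
  \sw2_(x1, x2 <- x) f x1 x2 =
  \sw2_(x1, x2 <- x) sgn K (deg homog x1 * deg homog x2) *: f x2 x1.
Proof.
move=> H_coc f_bil.
rewrite (sw2_rep (r := [seq (sgn K (deg homog u.1 * deg homog u.2) *: u.2, u.1)
  | u <- sw2 x]) f_bil).
  by rewrite big_map; apply: eq_bigr => -[x1 x2] _; exact: (linZ (f_bil.1 x1)).
rewrite H_coc big_map; apply: eq_bigr => -[x1 x2] _.
by rewrite tpureZl.
Qed.

Lemma linear_counit : scalar (@counit K H).
Proof. exact: counit_linear comul_hopf. Qed.

Lemma counitZ a (x : H) : counit (a *: x) = a * counit x.
Proof. by have := linear_counit a x 0; rewrite raddf0 !addr0. Qed.

Lemma counit_antipode (x : H) : counit (antipode x) = counit x.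
Proof.
have := congr1 counit (antipode_left comul_hopf x).
rewrite counitZ rmorph1 mulr1 => <-.
rewrite -[in LHS](counit_right comul_hopf x) !raddf_sum.
apply: eq_bigr => -[x1 x2] _ /=.
by rewrite (linZ (antipode_linear comul_hopf)) counitZ rmorphM mulrC.
Qed.

Lemma linear_antipode V (f : V -> H) :
  linear f -> linear (fun v => antipode (f v)).
Proof. exact/linear_comp_map/linearP. Qed.

Lemma linear_sw2_arg V W (f : H -> H -> V) (g : W -> H) :
  bilinear_map f -> linear g ->
  linear (fun w => \sw2_(a, b <- g w) f a b).
Proof. by move=> f_bil; apply: linear_comp_map (linear_sw2 f_bil). Qed.

Lemma linear_sw2_body V W (F : H -> H -> W -> V) x :
  (forall a b, linear (F a b)) ->
  linear (fun w => \sw2_(a, b <- x) F a b w).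
Proof. by move=> F_lin; apply: linear_big_sum => -[a b]. Qed.

Lemma linear_sw3_body V W (F : H -> H -> H -> W -> V) x :
  (forall a b c, linear (F a b c)) ->
  linear (fun w => \sw3_(a, b, c <- x) F a b c w).
Proof. by move=> F_lin; apply: linear_big_sum => -[[a b] c]. Qed.

Lemma linear_sw4_body V W (F : H -> H -> H -> H -> W -> V) x :
  (forall a b c d, linear (F a b c d)) ->
  linear (fun w => \sw4_(a, b, c, d <- x) F a b c d w).
Proof. by move=> F_lin; apply: linear_big_sum => -[[[a b] c] d]. Qed.

Lemma linear_sw3 V (f : H -> H -> H -> V) :
  trilinear_map f -> linear (fun x => \sw3_(a, b, c <- x) f a b c).
Proof.
move=> [f12 f3] a x y; rewrite !sw3E; apply: (linear_sw2 (f := fun u v => _)).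
split=> [u|u].
  by apply: linear_sw2_body => b c; apply: (f12 c).1.
by apply: linear_sw2; split=> v; [apply: (f12 v).2 | apply: f3].
Qed.

Lemma linear_sw3_arg V W (f : H -> H -> H -> V) (g : W -> H) :
  trilinear_map f -> linear g ->
  linear (fun w => \sw3_(a, b, c <- g w) f a b c).
Proof. by move=> f_tri; apply: linear_comp_map (linear_sw3 f_tri). Qed.

End SweedlerCalculus.

Section LinearGenerators.
Context (K : comNzRingType) (A B : gradedHopfType K).

Lemma linear_genl (U : lmodType K) (f : U -> A) (b : B) :
  linear f -> linear (fun u => gen (f u) b).
Proof. exact: linear_comp_map (gen_linearl b). Qed.

Lemma linear_genr (U : lmodType K) (f : U -> B) (x : A) :
  linear f -> linear (fun u => gen x (f u)).
Proof. exact: linear_comp_map (gen_linearr x). Qed.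

End LinearGenerators.

(** Proves multilinearity of an expression built from linear operations in which
    each bound variable occurs once.  The patterns keep the choice of a rule
    syntactic: an attempt to unify with a wrong rule unfolds the generators of
    A_B down to finitely supported functions. *)
Ltac multilin_step := cbv beta; match goal with
  | |- bilinear_map _ => split
  | |- trilinear_map _ => split
  | |- quadrilinear_map _ => split
  | |- GRing.linear_for *%R _ =>
      first [exact: linear_counit | match goal with h : _ |- _ => exact: h end]
  | |- GRing.linear_for _ (fun u => u) => exact: linear_id
  | |- GRing.linear_for _ (fun u => bigop.body _ ?r _) =>
      first [eapply linear_sw2_body | eapply linear_sw3_body
            | eapply linear_sw4_body]
  | |- GRing.linear_for _ (fun u => bigop.body _ (sw2 _) _) =>
      eapply linear_sw2_arg
  | |- GRing.linear_for _ (fun u => bigop.body _ (sw3 _) _) =>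
      eapply linear_sw3_arg
  | |- GRing.linear_for _ (fun u => ?a *: @?f u) =>
      refine (linear_scale a (f := f) _)
  | |- GRing.linear_for _ (fun u => @?f u *: ?v) =>
      refine (linear_scalel v (f := f) _)
  | |- GRing.linear_for _ (fun u => @?f u * ?r) =>
      refine (linear_mull r (f := f) _)
  | |- GRing.linear_for _ (fun u => ?r * @?f u) =>
      refine (linear_mulr r (f := f) _)
  | |- GRing.linear_for _ (fun u => @?f u ⊗ ?y) =>
      refine (linear_tpurel y (f := f) _)
  | |- GRing.linear_for _ (fun u => ?x ⊗ @?f u) =>
      refine (linear_tpurer x (f := f) _)
  | |- GRing.linear_for _ (fun u => gen (@?f u) ?b) =>
      refine (linear_genl b (f := f) _)
  | |- GRing.linear_for _ (fun u => gen ?x (@?f u)) =>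
      refine (linear_genr x (f := f) _)
  | |- GRing.linear_for _ (fun u => antipode (@?f u)) =>
      refine (linear_antipode (f := f) _)
  | h : quadrilinear_map ?F
    |- GRing.linear_for _ (fun u => ?F (@?f u) ?y ?z ?t) =>
      refine (linear_quadrilinear1 (g := f) y z t h _)
  | h : quadrilinear_map ?F
    |- GRing.linear_for _ (fun u => ?F ?x (@?f u) ?z ?t) =>
      refine (linear_quadrilinear2 (g := f) x z t h _)
  | h : quadrilinear_map ?F
    |- GRing.linear_for _ (fun u => ?F ?x ?y (@?f u) ?t) =>
      refine (linear_quadrilinear3 (g := f) x y t h _)
  | h : quadrilinear_map ?F
    |- GRing.linear_for _ (fun u => ?F ?x ?y ?z (@?f u)) =>
      refine (linear_quadrilinear4 (g := f) x y z h _)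
  | |- GRing.linear_for _ (?F ?x ?y ?z) =>
      match goal with h : quadrilinear_map F |- _ => exact: (h.2 x y z) end
  | h : trilinear_map ?F |- GRing.linear_for _ (fun u => ?F (@?f u) ?y ?z) =>
      refine (linear_trilinear1 (g := f) y z h _)
  | h : trilinear_map ?F |- GRing.linear_for _ (fun u => ?F ?x (@?f u) ?z) =>
      refine (linear_trilinear2 (g := f) x z h _)
  | h : trilinear_map ?F |- GRing.linear_for _ (fun u => ?F ?x ?y (@?f u)) =>
      refine (linear_trilinear3 (g := f) x y h _)
  | h : bilinear_map ?F |- GRing.linear_for _ (fun u => ?F (@?f u) ?y) =>
      refine (linear_bilinearl (g := f) y h _)
  | h : bilinear_map ?F |- GRing.linear_for _ (fun u => ?F ?x (@?f u)) =>
      refine (linear_bilinearr (g := f) x h _)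
  | |- forall _, _ => intro
  end.

Ltac multilin := repeat multilin_step.

Section ExchangeSweedler.
Context (K : comNzRingType) (G H : gradedHopfType K) (V : lmodType K).

Lemma exchange_sw2 (F : G -> G -> H -> H -> V) x y :
  \sw2_(a, b <- x) \sw2_(c, d <- y) F a b c d =
  \sw2_(c, d <- y) \sw2_(a, b <- x) F a b c d.
Proof.
transitivity (\sum_(u <- sw2 x) \sum_(v <- sw2 y) F u.1 u.2 v.1 v.2).
  by apply: eq_bigr => -[a b] _; apply: eq_bigr => -[].
rewrite exchange_big; apply: eq_bigr => -[c d] _ /=.
by apply: eq_bigr => -[].
Qed.

Lemma exchange_sw3_sw2 (F : G -> G -> G -> H -> H -> V) x y :
  \sw3_(a, b, c <- x) \sw2_(d, e <- y) F a b c d e =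
  \sw2_(d, e <- y) \sw3_(a, b, c <- x) F a b c d e.
Proof.
transitivity (\sum_(u <- sw3 x) \sum_(v <- sw2 y)
    F u.1.1 u.1.2 u.2 v.1 v.2).
  by apply: eq_bigr => -[[a b] c] _; apply: eq_bigr => -[].
rewrite exchange_big; apply: eq_bigr => -[d e] _ /=.
by apply: eq_bigr => -[[]].
Qed.

End ExchangeSweedler.

Section Rotation.
Context (K : comNzRingType) (H : gradedHopfType K).
Implicit Types (V W : lmodType K) (x : H).

(** Coassociativity in the form needed for rotations: the quadruple coproduct
    is also obtained by splitting the first tensor factor. *)
Lemma sw3A V (f : H -> H -> H -> H -> V) x : quadrilinear_map f ->
  \sw2_(u, d <- x) \sw3_(a, b, c <- u) f a b c d =
  \sw4_(a, b, c, d <- x) f a b c d.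
Proof.
move=> f_quad.
transitivity (\sw2_(u, d <- x) \sw2_(a, v <- u) \sw2_(b, c <- v) f a b c d).
  by apply: eq_bigr => -[u d] _; rewrite sw3E.
rewrite (sw2A (f := fun a v d => \sw2_(b, c <- v) f a b c d)).
  rewrite sw4E; apply: eq_bigr => -[a u] _; rewrite sw3E.
  by rewrite -sw2A //; multilin.
by multilin.
Qed.

(** Swapping the two factors of a cosymmetric element and splitting one of them
    further amounts to a cyclic rotation of the components. *)
Lemma cosymmetric_rot4 V (f : H -> H -> H -> H -> V) x :
    cosymmetric x -> quadrilinear_map f ->
  \sw4_(a, b, c, d <- x) f a b c d = \sw4_(a, b, c, d <- x) f d a b c.
Proof.
move=> x_sym f_quad.
transitivity (\sw2_(a, u <- x) \sw3_(b, c, d <- u) f a b c d).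
  exact: sw4E.
rewrite cosymmetric_sw2 //.
  by rewrite (sw3A _ (f := fun a b c d => f d a b c)) //; multilin.
by multilin.
Qed.

(** By coassociativity (c1, e1, e2, e3, c3) are five consecutive components of
    [c], so c1 s(e1) and e3 s(c3) are products of neighbours; both cancel and
    leave [c] in the middle slot. *)
Lemma sw3_antipode_cancel V (f : H -> H -> V) (c : H) :
    bilinear_map f ->
  \sw3_(c1, c2, c3 <- c) \sw3_(e1, e2, e3 <- c2)
    f e2 ((c1 * antipode e1) * (e3 * antipode c3)) = f c 1.
Proof.
move=> f_bil; rewrite sw3E.
transitivity (\sw2_(c1, u <- c) \sw2_(e1, t <- u) f t (c1 * antipode e1)).
  apply: eq_bigr => -[c1 u] _.
  pose Q e1 e2 e3 c3 := f e2 ((c1 * antipode e1) * (e3 * antipode c3)).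
  transitivity (\sw2_(c2, c3 <- u) \sw2_(e1, w <- c2) \sw2_(e2, e3 <- w)
      Q e1 e2 e3 c3).
    by apply: eq_bigr => -[c2 c3] _; rewrite sw3E.
  rewrite (sw2A (f := fun e1 w c3 => \sw2_(e2, e3 <- w) Q e1 e2 e3 c3));
    last by rewrite /Q; multilin.
  apply: eq_bigr => -[e1 t] _.
  rewrite (sw2A (f := Q e1)); last by rewrite /Q; multilin.
  rewrite -(sw2_counitr t (f := fun v => f v (c1 * antipode e1)));
    last by multilin.
  apply: eq_bigr => -[e2 v] _.
  rewrite (sw2_antipoder v (f := fun w => f e2 (c1 * antipode e1 * w)));
    last by multilin.
  by rewrite mulr1.
rewrite -(sw2A (f := fun c1 e1 t => f t (c1 * antipode e1)));
  last by multilin.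
rewrite -(sw2_counitl c (f := fun t => f t 1)); last by multilin.
apply: eq_bigr => -[v t] _.
by rewrite (sw2_antipoder v (f_bil.2 t)).
Qed.

End Rotation.

(** * Balanced forms and cosymmetric elements *)

Section BalancedForms.
Context (K : comNzRingType) (B : gradedHopfType K) (bul : B -> B -> K).
Context (B_mulC : forall b c : B, b * c = c * b).
Context (bul_l : forall c, scalar (bul^~ c)) (bul_r : forall b, scalar (bul b)).
Context (bul_balanced : balanced bul).

(** The counit of s(c') c''' leaves only the middle component, so applying it to
    both sides of the balancing axiom gives symmetry. *)
Lemma balanced_sym (b c : B) : bul b c = bul c b.
Proof.
pose e (z : B) := counit z *: (1 : B).
have e_lin : linear e by exact/linear_scalel/linear_counit.
have eZ a z : e (a *: z) = a *: e z by exact: linZ.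
have eM y z : e (y * z) = counit y *: (counit z *: 1).
  by rewrite /e rmorphM scalerA.
have collapse d x : \sw2_(x1, u <- x) \sw2_(x2, x3 <- u)
    counit x1 *: (counit x3 *: (bul d x2 *: (1 : B))) = bul d x *: 1.
  transitivity (\sw2_(x1, u <- x) counit x1 *: (bul d u *: (1 : B))).
    apply: eq_bigr => -[x1 u] _.
    have := sw2_counitr u (linear_scalel (1 : B) (bul_r d)) => <-.
    by rewrite scaler_sumr; apply: eq_bigr => -[].
  by rewrite (sw2_counitl (f := fun u => bul d u *: (1 : B))) //; multilin.
have : bul b c *: (1 : B) = bul c b *: 1.
  transitivity (e (\sw3_(c1, c2, c3 <- c) bul b c2 *: (antipode c1 * c3))).
    rewrite (lin_sumE e_lin) -(collapse b c).
    rewrite -(sw3E (fun x1 x2 x3 =>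
      counit x1 *: (counit x3 *: (bul b x2 *: (1 : B))))).
    apply: eq_bigr => -[[c1 c2] c3] _.
    by rewrite eZ eM counit_antipode !scalerA mulrC.
  rewrite bul_balanced (lin_sumE e_lin) -(collapse c b).
  rewrite -(sw3E (fun x1 x2 x3 =>
      counit x1 *: (counit x3 *: (bul c x2 *: (1 : B))))).
  apply: eq_bigr => -[[b1 b2] b3] _.
  by rewrite eZ eM counit_antipode !scalerA mulrC [counit b3 * _]mulrC.
by move/(congr1 counit); rewrite !counitZ rmorph1 !mulr1.
Qed.

(** Balancing trades a factor s(b''') b' produced by [b] for a factor s(c') c'''
    produced by [c], provided that the form pairs with the component between
    the two; cyclic rotations create this configuration and undo it. *)
Lemma balanced_exchange (V : lmodType K) (P : B -> B -> B -> V) (b c : B) :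
    trilinear_map P -> cosymmetric b -> cosymmetric c ->
  \sw4_(b1, b2, b3, b4 <- b) \sw2_(c1, c2 <- c)
    bul b1 c1 *: P b3 (antipode b2 * b4) c2 =
  \sw2_(b1, b2 <- b) \sw4_(c1, c2, c3, c4 <- c)
    bul b1 c1 *: P b2 (c2 * antipode c4) c3.
Proof.
move=> P_tri b_sym c_sym.
transitivity (\sw4_(b1, b2, b3, b4 <- b) \sw2_(c1, c2 <- c)
    bul b3 c1 *: P b1 (antipode b4 * b2) c2).
  rewrite (cosymmetric_rot4 (f := fun b1 b2 b3 b4 => \sw2_(c1, c2 <- c)
    bul b1 c1 *: P b3 (antipode b2 * b4) c2)) //; last by multilin.
  rewrite (cosymmetric_rot4 (f := fun b1 b2 b3 b4 => \sw2_(c1, c2 <- c)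
    bul b4 c1 *: P b2 (antipode b1 * b3) c2)) //.
  by multilin.
rewrite sw4E [RHS](cosymmetric_sw2 (f := fun b1 b2 =>
  \sw4_(c1, c2, c3, c4 <- c) bul b1 c1 *: P b2 (c2 * antipode c4) c3)) //;
  last by multilin.
apply: eq_bigr => -[b1 b'] _.
(* The component b' now carries the pattern of the balancing axiom. *)
transitivity (\sw2_(c', c4 <- c)
    P b1 (\sw3_(b2, b3, b4 <- b') bul c' b3 *: (antipode b4 * b2)) c4).
  rewrite exchange_sw3_sw2; apply: eq_bigr => -[c' c4] _.
  rewrite (lin_sumE ((P_tri.1 c4).2 b1)); apply: eq_bigr => -[[b2 b3] b4] _.
  by rewrite (linZ ((P_tri.1 c4).2 b1)) balanced_sym.
transitivity (\sw4_(c1, c2, c3, c4 <- c)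
    bul b' c2 *: P b1 (antipode c1 * c3) c4).
  rewrite -(sw3A (f := fun c1 c2 c3 c4 =>
    bul b' c2 *: P b1 (antipode c1 * c3) c4)); last by multilin.
  apply: eq_bigr => -[c' c4] _; rewrite -bul_balanced.
  rewrite (lin_sumE ((P_tri.1 c4).2 b1)); apply: eq_bigr => -[[c1 c2] c3] _.
  by rewrite (linZ ((P_tri.1 c4).2 b1)).
rewrite (cosymmetric_rot4 (f := fun c1 c2 c3 c4 =>
    bul b' c2 *: P b1 (antipode c1 * c3) c4)) //; last by multilin.
by apply: eq_bigr => -[[[c1 c2] c3] c4] _; rewrite [antipode c4 * c2]B_mulC.
Qed.
End BalancedForms.

(** * Signs and degrees *)

Section Signs.
Context (K : comNzRingType).

Lemma sgnD (k l : int) : sgn K (k + l) = sgn K k * sgn K l.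
Proof.
rewrite /sgn -exprD -signr_odd -[RHS]signr_odd; congr ((-1) ^+ nat_of_bool _).
by rewrite oddD; lia.
Qed.

Lemma sgn_sqr (k : int) : sgn K k * sgn K k = 1.
Proof. by rewrite /sgn -exprMn mulrNN mul1r expr1n. Qed.

Lemma homog_deg (V : lmodType K) (G : int -> V -> Prop) (v : V) :
  homogeneous G v -> G (deg G v) v.
Proof. by rewrite /deg => -[p Gp]; case: xgetP => [q _ //|/(_ p)]. Qed.

End Signs.

Section TensorMultiplication.
Context (K : comNzRingType) (R S : algType K).
Context (G : int -> R -> Prop) (H : int -> S -> Prop).

(** When the second factor sits in degree 0 no sign survives, and the product
    of tensors is given by the naive formula on arbitrary, not necessarily
    homogeneous, expressions. *)
Lemma tens_mul_sum (r s : seq (R * S)) :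
    homog_spanned G -> homog_spanned H ->
    (forall p x, p != 0 -> H p x -> x = 0) ->
  tens_mul G H (\sum_(i <- r) i.1 ⊗ i.2) (\sum_(j <- s) j.1 ⊗ j.2) =
  \sum_(i <- r) \sum_(j <- s) (i.1 * j.1) ⊗ (i.2 * j.2).
Proof.
move=> G_span H_span H0.
set t := \sum_(i <- r) i.1 ⊗ i.2; set u := \sum_(j <- s) j.1 ⊗ j.2.
have [tE ht] := hrepP t G_span H_span; have [uE _] := hrepP u G_span H_span.
pose f v b := \sum_(j <- s) (v * j.1 : R) ⊗ (b * j.2 : S).
have f_bil : bilinear_map f.
  by split=> [b|v]; apply: linear_big_sum => -[w c]; multilin.
rewrite -[RHS](tens_sum_bilinear (r := hrep G H t) f_bil (esym tE)).
rewrite /tens_mul big_seq [RHS]big_seq.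
apply: eq_bigr => -[v b] /ht [_ /= hb]; rewrite /f /=.
have g_bil : bilinear_map (fun (w : R) (c : S) => (v * w) ⊗ (b * c)).
  by multilin.
rewrite -(tens_sum_bilinear g_bil (esym uE)); apply: eq_bigr => -[w c] _ /=.
have [d0|/H0/(_ (homog_deg hb)) ->] := eqVneq (deg H b) 0.
  by rewrite d0 mul0r /sgn expr0 scale1r.
by rewrite mul0r !raddf0.
Qed.

End TensorMultiplication.

(** * Generators of the representation algebra *)

Section RepresentationAlgebra.
Context (K : comNzRingType) (A B : gradedHopfType K).
Implicit Types (x y z a : A) (b c : B).

(** Both sides are obtained from the sum of
    a'_(s b') a''_(b'') (s a''')_(b''')
    by contracting either the first two factors or the last two. *)
Lemma gen_antipode a b : gen (antipode a) b = gen a (antipode b).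
Proof.
pose F a1 a2 a3 b1 b2 b3 : repalg A B :=
  gen a1 (antipode b1) * gen a2 b2 * gen (antipode a3) b3.
transitivity (\sw2_(a', a3 <- a) \sw2_(b', b3 <- b)
    \sw2_(b1, b2 <- b') \sw2_(a1, a2 <- a') F a1 a2 a3 b1 b2 b3).
  rewrite -[LHS](sw2_counitl (f := fun a3 => gen (antipode a3) b));
    last by multilin.
  apply: eq_bigr => -[a' a3] _.
  rewrite -(sw2_counitl b (f := gen (antipode a3))); last exact: gen_linearr.
  rewrite scaler_sumr; apply: eq_bigr => -[b' b3] _.
  transitivity ((\sw2_(b1, b2 <- b') gen a' (antipode b1 * b2)) *
    gen (antipode a3) b3).
    rewrite (sw2_antipodel _ (gen_linearr a')) gen_1r -!scalerAl mul1r.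
    by rewrite !scalerA mulrC.
  rewrite mulr_suml; apply: eq_bigr => -[b1 b2] _.
  by rewrite gen_mulr mulr_suml; apply: eq_bigr => -[a1 a2] _.
transitivity (\sw2_(b1, b' <- b) \sw2_(a1, a' <- a) \sw2_(a2, a3 <- a')
    \sw2_(b2, b3 <- b') F a1 a2 a3 b1 b2 b3).
  transitivity (\sw2_(a', a3 <- a) \sw2_(b1, b' <- b)
      \sw2_(b2, b3 <- b') \sw2_(a1, a2 <- a') F a1 a2 a3 b1 b2 b3).
    apply: eq_bigr => -[a' a3] _.
    by rewrite (sw2A (f := fun b1 b2 b3 => \sw2_(a1, a2 <- a')
      F a1 a2 a3 b1 b2 b3)) // /F; multilin.
  rewrite exchange_sw2; apply: eq_bigr => -[b1 b'] _.
  rewrite -(sw2A (f := fun a1 a2 a3 => \sw2_(b2, b3 <- b')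
      F a1 a2 a3 b1 b2 b3)); last by rewrite /F; multilin.
  by apply: eq_bigr => -[a' a3] _; rewrite exchange_sw2.
rewrite -[RHS](sw2_counitr (f := fun b1 => gen a (antipode b1)));
  last by multilin.
apply: eq_bigr => -[b1 b'] _.
rewrite -(sw2_counitr a (f := fun a1 => gen a1 (antipode b1)));
  last by multilin.
rewrite scaler_sumr; apply: eq_bigr => -[a1 a'] _.
transitivity (gen a1 (antipode b1) *
    \sw2_(a2, a3 <- a') gen (a2 * antipode a3) b').
  rewrite mulr_sumr; apply: eq_bigr => -[a2 a3] _; rewrite gen_mull mulr_sumr.
  by apply: eq_bigr => -[b2 b3] _; rewrite mulrA.
rewrite (sw2_antipoder _ (gen_linearl b')) gen_1l -!scalerAr mulr1.
by rewrite !scalerA mulrC.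
Qed.

Context (B_ungraded : ungraded B).

(** The degree of x_b is thus that of x: elements of B contribute no signs. *)
Lemma ungraded_homog0 b : homog 0 b.
Proof.
have gr := graded_grading (@homog_graded K B).
have [bE hs] := hpartsP b (grading_sum gr); rewrite bE big_seq.
apply: big_ind => [|u v hu hv|u /hs [p hu]]; first exact: grading0 gr 0.
  by rewrite -[u]scale1r; apply: gradingP.
have [<-//|p0] := eqVneq p 0.
by rewrite (B_ungraded p0 hu); apply: grading0 gr 0.
Qed.

Lemma gen_swap p q x y b c : homog p x -> homog q y ->
  gen x b * gen y c = sgn K (p * q) *: (gen y c * gen x b).
Proof.
move=> hx hy.
rewrite (gen_comm hx (ungraded_homog0 b) hy (ungraded_homog0 c)).
by rewrite !addr0.
Qed.

Lemma gen_swap_sgn p q x y b c : homog p x -> homog q y ->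
  sgn K (p * q) *: (gen x b * gen y c) = gen y c * gen x b.
Proof.
by move=> hx hy; rewrite (gen_swap _ _ hx hy) scalerA sgn_sqr scale1r.
Qed.

(** The sign of the adjoint action is the one that appears when the antipode
    factor is moved past x to meet the last factor. *)
Lemma gen_adr x a b : gen (adr x a) b =
  \sw3_(b1, b2, b3 <- b) (gen x b2 * gen a (antipode b1 * b3)).
Proof.
have [xE hx] := hpartsP x (@homog_spanned_hopf K A).
rewrite (lin_sumE (gen_linearl b)).
transitivity (\sum_(z <- hparts homog x)
    \sw3_(b1, b2, b3 <- b) (gen z b2 * gen a (antipode b1 * b3))).
  rewrite !big_seq; apply: eq_bigr => z /hx hz.
  rewrite (lin_sumE (gen_linearl b)).
  transitivity (\sw2_(a1, a2 <- a) \sw3_(b1, b2, b3 <- b)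
      (gen z b2 * (gen a1 (antipode b1) * gen a2 b3))).
    rewrite !big_seq; apply: eq_bigr => -[a1 a2] /(sw2P a).2 [/= ha1 _].
    rewrite (linZ (gen_linearl b)) -mulrA gen_mull sw3E scaler_sumr.
    apply: eq_bigr => -[b1 b'] _; rewrite gen_mull mulr_sumr scaler_sumr.
    apply: eq_bigr => -[b2 b3] _.
    rewrite gen_antipode !mulrA scalerAl; congr (_ * _).
    by rewrite mulrC (gen_swap_sgn _ _ (homog_deg ha1) (homog_deg hz)).
  rewrite -exchange_sw3_sw2; apply: eq_bigr => -[[b1 b2] b3] _.
  by rewrite gen_mulr mulr_sumr; apply: eq_bigr => -[].
rewrite [in RHS]xE -[LHS](lin_sumE (f := fun z =>
  \sw3_(b1, b2, b3 <- b) (gen z b2 * gen a (antipode b1 * b3)))) //.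
by multilin.
Qed.

Lemma gen_adl y a c : gen (adl a y) c =
  \sw3_(c1, c2, c3 <- c) (gen a (c1 * antipode c3) * gen y c2).
Proof.
have [yE hy] := hpartsP y (@homog_spanned_hopf K A).
rewrite (lin_sumE (gen_linearl c)).
transitivity (\sum_(z <- hparts homog y)
    \sw3_(c1, c2, c3 <- c) (gen a (c1 * antipode c3) * gen z c2)).
  rewrite !big_seq; apply: eq_bigr => z /hy hz.
  rewrite (lin_sumE (gen_linearl c)).
  transitivity (\sw2_(a1, a2 <- a) \sw3_(c1, c2, c3 <- c)
      (gen a1 c1 * gen a2 (antipode c3) * gen z c2)).
    rewrite !big_seq; apply: eq_bigr => -[a1 a2] /(sw2P a).2 [/= _ ha2].
    rewrite (linZ (gen_linearl c)) -mulrA gen_mull sw3E scaler_sumr.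
    apply: eq_bigr => -[c1 c'] _; rewrite gen_mull mulr_sumr scaler_sumr.
    apply: eq_bigr => -[c2 c3] _.
    rewrite gen_antipode -!mulrA scalerAr; congr (_ * _).
    by rewrite (gen_swap_sgn _ _ (homog_deg hz) (homog_deg ha2)).
  rewrite -exchange_sw3_sw2; apply: eq_bigr => -[[c1 c2] c3] _.
  by rewrite gen_mulr mulr_suml; apply: eq_bigr => -[].
rewrite [in RHS]yE -[LHS](lin_sumE (f := fun z =>
  \sw3_(c1, c2, c3 <- c) (gen a (c1 * antipode c3) * gen z c2))) //.
by multilin.
Qed.

(** (yz)_b = y_(b') z_(b'') agrees, up to the sign of a graded commutator, with
    (zy)_b once b' and b'' may be interchanged. *)
Lemma gen_comm_cls x y b : cosymmetric b -> comm_cls x = comm_cls y ->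
  gen x b = gen y b.
Proof.
move=> b_sym /lproj_eqP xy; apply/eqP; rewrite -subr_eq0.
rewrite -(linB (gen_linearl b)); apply/eqP; elim: xy => {x y}.
- move=> _ [p [q [x [y [hx hy ->]]]]].
  rewrite (linB (gen_linearl b)) (linZ (gen_linearl b)).
  rewrite !gen_mull scaler_sumr.
  apply/eqP; rewrite subr_eq0; apply/eqP.
  rewrite (cosymmetric_sw2 (f := fun b1 b2 => gen x b1 * gen y b2)) //;
    last by multilin.
  by apply: eq_bigr => -[b1 b2] _; apply: gen_swap.
- exact: lin0 (gen_linearl b).
- by move=> k u v _ u0 _ v0; rewrite gen_linearl u0 v0 scaler0 addr0.
Qed.

(** * The map attached to two cosymmetric elements *)

Section Smile.
Context (bul : B -> B -> K).
Context (B_mulC : forall b c : B, b * c = c * b).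
Context (bul_l : forall c, scalar (bul^~ c)) (bul_r : forall b, scalar (bul b)).
Context (bul_balanced : balanced bul) (b c : B).
Context (b_sym : cosymmetric b) (c_sym : cosymmetric c).

Definition smile_pure x y : repalg A B :=
  \sw2_(b1, b2 <- b) \sw2_(c1, c2 <- c) bul b1 c1 *: (gen x b2 * gen y c2).

Lemma smile_pure_bilinear : bilinear_map smile_pure.
Proof. by rewrite /smile_pure; multilin. Qed.

Definition gen3 x a y (u w v : B) : repalg A B := gen x u * gen a w * gen y v.

Lemma gen3_trilinear x a y : trilinear_map (gen3 x a y).
Proof. by rewrite /gen3; multilin. Qed.

Lemma smile_pure_adr x a y : smile_pure (adr x a) y =
  \sw4_(b1, b2, b3, b4 <- b) \sw2_(c1, c2 <- c)
    bul b1 c1 *: gen3 x a y b3 (antipode b2 * b4) c2.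
Proof.
rewrite sw4E; apply: eq_bigr => -[b1 b'] _.
rewrite exchange_sw3_sw2; apply: eq_bigr => -[c1 c2] _.
rewrite gen_adr mulr_suml scaler_sumr.
by apply: eq_bigr => -[[b2 b3] b4].
Qed.

Lemma smile_pure_adl x a y : smile_pure x (adl a y) =
  \sw2_(b1, b2 <- b) \sw4_(c1, c2, c3, c4 <- c)
    bul b1 c1 *: gen3 x a y b2 (c2 * antipode c4) c3.
Proof.
apply: eq_bigr => -[b1 b2] _; rewrite sw4E; apply: eq_bigr => -[c1 c'] _.
rewrite gen_adl mulr_sumr scaler_sumr.
by apply: eq_bigr => -[[c2 c3] c4] _; rewrite mulrA.
Qed.

(** This is what makes the map well defined on the tensor product over A. *)
Lemma smile_pure_ad x a y : smile_pure (adr x a) y = smile_pure x (adl a y).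
Proof.
rewrite smile_pure_adr smile_pure_adl.
exact: balanced_exchange (gen3_trilinear x a y) b_sym c_sym.
Qed.

(** The map is defined through a chosen representative; two representatives
    differ by a combination of the relations killed by [smile_pure_ad]. *)
Lemma smile_adpure_sum (r : seq (A * A)) :
  smile bul b c (\sum_(i <- r) adpure i.1 i.2) =
  \sum_(i <- r) smile_pure i.1 i.2.
Proof.
have [F FE] := tens_univ smile_pure_bilinear.1 smile_pure_bilinear.2.
have F_lin : linear F := linearP F.
have FsE (s : seq (A * A)) :
    \sum_(i <- s) smile_pure i.1 i.2 = F (\sum_(i <- s) i.1 ⊗ i.2).
  by rewrite raddf_sum; apply: eq_bigr => i _; rewrite /= FE.
rewrite FsE; set w := \sum_(i <- r) _ ⊗ _.
have -> : \sum_(i <- r) adpure i.1 i.2 = lproj (@ad_rel K A) w.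
  by rewrite raddf_sum.
have [tE _] := hrepP (repr (lproj (@ad_rel K A) w))
  (@homog_spanned_hopf K A) (@homog_spanned_hopf K A).
rewrite /smile -/(smile_pure _ _) FsE -tE; apply/eqP.
rewrite -subr_eq0 -(linB F_lin); apply/eqP.
have /lproj_eqP := lproj_repr (lproj (@ad_rel K A) w).
elim=> [_ [x [a [y ->]]]||k u v _ u0 _ v0].
- by rewrite (linB F_lin) !FE smile_pure_ad subrr.
- exact: lin0 F_lin.
- by rewrite F_lin u0 v0 scaler0 addr0.
Qed.

(** Cocommutativity interchanges x' and x'' at the cost of the sign of
    |x'| |x''|; moving x'' past rho(x', y') contributes |x''| (|x'| + |y'| + n).
    The product of the two signs is the one in the bracket formula. *)
Lemma bracket_formula_smile (n : int) (rho : A -> A -> A) x y :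
    graded_cocommutative A -> Fox_pairing n rho ->
  \sw2_(x1, x2 <- x) \sw2_(y1, y2 <- y)
  \sw4_(b1, b2, b3, b4 <- b) \sw2_(c1, c2 <- c)
    (sgn K (deg homog x2 * (deg homog y1 + n)) * bul c2 b2) *:
    (gen (rho x1 y1) (antipode b3 * b1) * gen x2 b4 * gen y2 c1) =
  \sw2_(x1, x2 <- x) \sw2_(y1, y2 <- y) smile_pure (adr x1 (rho x2 y1)) y2.
Proof.
move=> A_coc rho_Fox.
have rho_bil : bilinear_map rho.
  by split; [exact: Fox_linearl rho_Fox | exact: Fox_linearr rho_Fox].
rewrite exchange_sw2 [RHS]exchange_sw2 !big_seq.
apply: eq_bigr => -[y1 y2] /(sw2P y).2 [/= hy1 _].
(* The bracket formula with x1 and x2 exchanged, up to its sign and the order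
   of its first two factors. *)
pose E x1 x2 := \sw4_(b1, b2, b3, b4 <- b) \sw2_(c1, c2 <- c)
  bul b2 c2 *: gen3 x1 (rho x2 y1) y2 b4 (antipode b3 * b1) c1.
have E_bil : bilinear_map E by rewrite /E /gen3; multilin.
transitivity (\sw2_(x1, x2 <- x) E x1 x2); last first.
  apply: eq_bigr => -[x1 x2] _; rewrite smile_pure_adr /E.
  rewrite (cosymmetric_rot4 (f := fun b1 b2 b3 b4 => \sw2_(c1, c2 <- c)
    bul b2 c2 *: gen3 x1 (rho x2 y1) y2 b4 (antipode b3 * b1) c1)) //;
    last first.
    by rewrite /gen3; multilin.
  apply: eq_bigr => -[[[b1 b2] b3] b4] _.
  rewrite (cosymmetric_sw2 (f := fun c1 c2 =>
    bul b1 c2 *: gen3 x1 (rho x2 y1) y2 b3 (antipode b2 * b4) c1)) //.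
  by rewrite /gen3; multilin.
rewrite (cocommutative_sw2 x A_coc E_bil) !big_seq.
apply: eq_bigr => -[x1 x2] /(sw2P x).2 [/= hx1 hx2].
rewrite scaler_sumr; apply: eq_bigr => -[[[b1 b2] b3] b4] _.
rewrite scaler_sumr; apply: eq_bigr => -[c1 c2] _; rewrite /gen3.
rewrite (balanced_sym bul_r bul_balanced c2).
have hrho := Fox_homog rho_Fox (homog_deg hx1) (homog_deg hy1).
rewrite (gen_swap _ _ (homog_deg hx2) hrho) -!scalerAl !scalerA.
congr (_ *: _); rewrite [RHS]mulrAC; congr (_ * _).
rewrite -addrA [in RHS]mulrDr [deg _ x1 * _]mulrC sgnD mulrA sgn_sqr.
by rewrite mul1r.
Qed.

End Smile.

(** * Coinvariance *)

Section Coinvariance.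
Context (D : repalg A B -> tens (repalg A B) B).
Context (D_coaction : canonical_coaction D).

Lemma coaction_gen_mul x y b c : D (gen x b * gen y c) =
  \sw3_(b1, b2, b3 <- b) \sw3_(c1, c2, c3 <- c)
    (gen x b2 * gen y c2) ⊗ (antipode b1 * b3 * (antipode c1 * c3)).
Proof.
pose r (z : A) (d : B) : seq (repalg A B * B) :=
  [seq (gen z u.1.2, antipode u.1.1 * u.2) | u <- sw3 d].
have DE z d : D (gen z d) = \sum_(i <- r z d) i.1 ⊗ i.2.
  by rewrite (coact_gen D_coaction) big_map; apply: eq_bigr => -[[d1 d2] d3].
rewrite (coactM D_coaction) !DE tens_mul_sum //; last first.
- exact: homog_spanned_hopf.
- exact: repalg_spanned.
rewrite big_map.
apply: eq_bigr => -[[b1 b2] b3] _; rewrite big_map.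
by apply: eq_bigr => -[[c1 c2] c3].
Qed.

Context (bul : B -> B -> K).
Context (B_mulC : forall b c : B, b * c = c * b).
Context (bul_l : forall c, scalar (bul^~ c)) (bul_r : forall b, scalar (bul b)).
Context (bul_balanced : balanced bul) (b c : B).
Context (b_sym : cosymmetric b) (c_sym : cosymmetric c).

Lemma coaction_smile_pure x y :
  D (smile_pure bul b c x y) = smile_pure bul b c x y ⊗ 1.
Proof.
have D_lin := coact_linear D_coaction.
(* The last slot carries the whole coaction of y; the first two carry x and
   the factor that b contributes to B. *)
pose P u w v : tens (repalg A B) B := \sw3_(v1, v2, v3 <- v)
  (gen x u * gen y v2) ⊗ (w * (antipode v1 * v3)).
have P_tri : trilinear_map P by rewrite /P; multilin.
transitivity (\sw4_(b1, b2, b3, b4 <- b) \sw2_(c1, c2 <- c)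
    bul b1 c1 *: P b3 (antipode b2 * b4) c2).
  rewrite (lin_sumE D_lin) sw4E; apply: eq_bigr => -[b1 b'] _.
  rewrite (lin_sumE D_lin) exchange_sw3_sw2; apply: eq_bigr => -[c1 c2] _.
  rewrite (linZ D_lin) coaction_gen_mul scaler_sumr.
  by apply: eq_bigr => -[[b2 b3] b4] _.
rewrite (balanced_exchange B_mulC bul_l bul_r bul_balanced P_tri b_sym c_sym).
rewrite /smile_pure tpure_suml; apply: eq_bigr => -[b1 b2] _.
rewrite tpure_suml sw4E; apply: eq_bigr => -[c1 c'] _; rewrite tpureZl.
pose f v w : tens (repalg A B) B := (gen x b2 * gen y v) ⊗ w.
have f_bil : bilinear_map f by rewrite /f; multilin.
rewrite -[_ ⊗ 1]/(f c' 1) -(sw3_antipode_cancel c' f_bil) scaler_sumr.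
apply: eq_bigr => -[[c2 c3] c4] _; congr (_ *: _).
apply: eq_bigr => -[[e1 e2] e3] _; rewrite /f; congr (_ ⊗ _).
by rewrite -!mulrA; congr (_ * _); rewrite B_mulC -mulrA.
Qed.

Lemma coinvariant_smile (t : adtens A) : coinvariant D (smile bul b c t).
Proof.
rewrite /coinvariant /smile (lin_sumE (coact_linear D_coaction)) tpure_suml.
by apply: eq_bigr => i _; apply: coaction_smile_pure.
Qed.

End Coinvariance.
End RepresentationAlgebra.

Theorem theorem11p3 (K : comNzRingType) (A B : gradedHopfType K) (n : int)
  (rho : A -> A -> A) (bul : B -> B -> K)
  (D : repalg A B -> tens (repalg A B) B)
  (br : repalg A B -> repalg A B -> repalg A B)
  (A_cocommutative : graded_cocommutative A)
  (rho_Fox : Fox_pairing n rho)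
  (rho_antisymmetric : Fox_antisymmetric n rho)
  (B_commutative : graded_commutative B)
  (B_ungraded : ungraded B)
  (bul_biderivation : biderivation bul)
  (bul_balanced : balanced bul)
  (D_coaction : canonical_coaction D)
  (br_bracket : graded_bracket (@repalg_homog K A B) n br)
  (br_gen : forall (x y : A) (b c : B),
    br (gen x b) (gen y c) =
    \sw2_(x1, x2 <- x) \sw2_(y1, y2 <- y)
    \sw4_(b1, b2, b3, b4 <- b) \sw2_(c1, c2 <- c)
      (sgn K (deg homog x2 * (deg homog y1 + n)) * bul c2 b2) *:
      (gen (rho x1 y1) (antipode b3 * b1) * gen x2 b4 * gen y2 c1)) :
  forall (x y : A) (b c : B), cosymmetric b -> cosymmetric c ->
    br (gen x b) (gen y c) =
      smile bul b c (Theta rho (comm_cls x) (comm_cls y)) /\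
    coinvariant D (smile bul b c (Theta rho (comm_cls x) (comm_cls y))).
Proof.
move=> x y b c b_sym c_sym.
have B_mulC (d e : B) : d * e = e * d.
  have d0 := ungraded_homog0 B_ungraded.
  by rewrite (B_commutative _ _ _ _ (d0 d) (d0 e)) mulr0 /sgn expr0 scale1r.
have bul_l := bider_linearl bul_biderivation.
have bul_r := bider_linearr bul_biderivation.
split; last exact: coinvariant_smile.
(* Theta is evaluated on these representatives. *)
set X := repr (comm_cls x); set Y := repr (comm_cls y).
have -> : gen x b = gen X b.
  by apply: gen_comm_cls => //; rewrite [RHS]lproj_repr.
have -> : gen y c = gen Y c.
  by apply: gen_comm_cls => //; rewrite [RHS]lproj_repr.
rewrite br_gen bracket_formula_smile //.
pose r := [seq (adr u.1 (rho u.2 v.1), v.2) | u <- sw2 X, v <- sw2 Y].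
have -> : Theta rho (comm_cls x) (comm_cls y) = \sum_(i <- r) adpure i.1 i.2.
  rewrite big_allpairs_dep; apply: eq_bigr => -[x1 x2] _.
  by apply: eq_bigr => -[y1 y2] _.
rewrite smile_adpure_sum // big_allpairs_dep; apply: eq_bigr => -[x1 x2] _.
by apply: eq_bigr => -[y1 y2] _.
Qed.
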